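(* Let $f,g,\beta$ satisfy the standing assumptions below, and let $\{(x_k,y_k)\}$ be generated by $x_{k+1}=x_k-\eta_k(u_{x,k}+\xi_{x,k})$, $y_{k+1}=y_k-\eta_k(u_{y,k}+\xi_{y,k})$ for some sequences $\eta_k>0$, $u_{x,k},\xi_{x,k}\in\mathbb{R}^n$, $u_{y,k},\xi_{y,k}\in\mathbb{R}^p$. Suppose conditions (a)–(f) below hold for some set-valued map $\mathcal{D}$ and constant $\delta>0$. Then every limit point of $\{(x_k,y_k)\}$ lies in $\{(x,y):0\in\mathcal{D}(x,y)\}$, and the sequence $\{h(x_k,y_k)\}$ converges. (a) $\sup_k\|x_k\|+\|y_k\|<\infty$. (b) $\eta_k>0$, $\sum_k\eta_k=\infty$, $\sum_k\eta_k^2<\infty$. (c) There exist $v_x\in\mathbb{R}^n,v_y\in\mathbb{R}^p$ with $\lim_{N\to\infty}\sum_{k=0}^N\eta_k\xi_{x,k}=v_x$ and $\lim_{N\to\infty}\sum_{k=0}^N\eta_k\xi_{y,k}=v_y$. (d) $\mathcal{D}:\mathbb{R}^n\times\mathbb{R}^p\rightrightarrows\mathbb{R}^n\times\mathbb{R}^p$ has closed graph and compact convex values, and for any unbounded increasing sequence $\{k_j\}$ with $(x_{k_j},y_{k_j})\to(\tilde x,\tilde y)$, $\lim_{N\to\infty}\mathrm{dist}\big(\frac1N\sum_{j=1}^N(u_{x,k_j},u_{y,k_j}),\mathcal{D}(\tilde x,\tilde y)\big)=0$. (e) The set $\{h(x,y):0\in\mathcal{D}(x,y)\}$ has empty interior.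 (f) For all $(x,y)$ and all $w\in\mathcal{D}(x,y)$, $\sup_{\zeta\in\mathcal{D}_h(x,y)}\zeta^\top w\ge\delta\|w\|^2$.
   Context: Standing assumptions. (A1) Constants $M_f,\mu,L_g,Q_g>0$ exist such that: $f:\mathbb{R}^n\times\mathbb{R}^p\to\mathbb{R}$ is $M_f$-Lipschitz; $g$ is twice differentiable with $\nabla^2_{yy}g\succeq\mu I_p$; $\nabla g$ is $L_g$-Lipschitz; $\nabla^2_{yy}g,\nabla^2_{xy}g$ are $Q_g$-Lipschitz; $\nabla^2_{yy}g$ is continuously differentiable ($\nabla^2_{xy}g\in\mathbb{R}^{n\times p}$ has entries $\partial^2g/\partial x_i\partial y_j$). (A2) $f$ is a potential function of a conservative field $\mathcal{D}_f$ with compact convex values of norm at most $M_f$ (conservative field: closed graph, nonempty compact values, $\int_0^1\max_{v\in\mathcal{D}(\gamma(t))}\langle\gamma'(t),v\rangle dt=0$ along every absolutely continuous loop; potential: $f(\gamma(1))-f(\gamma(0))$ equals this integral along any absolutely continuous curve). $\beta>0$. Notation: $H=\nabla^2_{yy}g(x,y)$, $\mathcal{A}(x,y):=y-H^{-1}\nabla_yg(x,y)$, $h(x,y):=f(x,\mathcal{A}(x,y))+\frac\beta2\|\nabla_yg(x,y)\|^2$; $\nabla^3_{xyy}g(x,y)[d]:=\lim_{t\to0}\frac1t(\nabla^2_{xy}g(x,y+td)-\nabla^2_{xy}g(x,y))$, $\nabla^3_{yyy}g(x,y)[d]:=\lim_{t\to0}\frac1t(\nabla^2_{yy}g(x,y+td)-\nabla^2_{yy}g(x,y))$;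 $J_{A,x}:=-\nabla^2_{xy}gH^{-1}+\nabla^3_{xyy}g[H^{-1}\nabla_yg]H^{-1}$, $J_{A,y}:=\nabla^3_{yyy}g[H^{-1}\nabla_yg]H^{-1}$; $\mathcal{D}_h(x,y):=\{(d_x+J_{A,x}d_y+\beta\nabla^2_{xy}g\nabla_yg,\ J_{A,y}d_y+\beta H\nabla_yg):(d_x,d_y)\in\mathcal{D}_f(x,\mathcal{A}(x,y))\}$, all evaluated at $(x,y)$. *)

(* Defs.v *)
From HB Require Import structures.
From mathcomp Require Import all_boot all_order all_algebra.
From mathcomp Require Import all_classical all_reals all_analysis.
Set Implicit Arguments. Unset Strict Implicit. Unset Printing Implicit Defensive.
Import Order.TTheory GRing.Theory Num.Theory.
Import numFieldNormedType.Exports.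
Local Open Scope classical_set_scope.
Local Open Scope ring_scope.

Section Defs.
Variables (R : realType) (n p : nat).

Definition dotv (m : nat) (u v : 'cV[R]_m) : R := \sum_i u i 0 * v i 0.
Definition enorm (m : nat) (u : 'cV[R]_m) : R := Num.sqrt (dotv u u).
Definition pdot (a b : 'cV[R]_n * 'cV[R]_p) : R := dotv a.1 b.1 + dotv a.2 b.2.
Definition pnorm (a : 'cV[R]_n * 'cV[R]_p) : R := Num.sqrt (pdot a a).

Definition ex (i : 'I_n) : 'cV[R]_n := delta_mx i 0.
Definition ey (j : 'I_p) : 'cV[R]_p := delta_mx j 0.

Section Derivs.
Variable g : 'cV[R]_n * 'cV[R]_p -> R.

Definition grad_x (z : 'cV[R]_n * 'cV[R]_p) : 'cV[R]_n :=
  \col_i derive g z (ex i, 0).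
Definition grad_y (z : 'cV[R]_n * 'cV[R]_p) : 'cV[R]_p :=
  \col_j derive g z (0, ey j).
Definition hess_yy (z : 'cV[R]_n * 'cV[R]_p) : 'M[R]_p :=
  \matrix_(i, j) derive (fun w => grad_y w j 0) z (0, ey i).
Definition hess_xy (z : 'cV[R]_n * 'cV[R]_p) : 'M[R]_(n, p) :=
  \matrix_(i, j) derive (fun w => grad_y w j 0) z (ex i, 0).
Definition d3xyy (z : 'cV[R]_n * 'cV[R]_p) (d : 'cV[R]_p) : 'M[R]_(n, p) :=
  derive hess_xy z (0, d).
Definition d3yyy (z : 'cV[R]_n * 'cV[R]_p) (d : 'cV[R]_p) : 'M[R]_p :=
  derive hess_yy z (0, d).

Definition Hinv (z : 'cV[R]_n * 'cV[R]_p) : 'M[R]_p := invmx (hess_yy z).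
Definition Amap (z : 'cV[R]_n * 'cV[R]_p) : 'cV[R]_p :=
  z.2 - Hinv z *m grad_y z.
Definition JAx (z : 'cV[R]_n * 'cV[R]_p) : 'M[R]_(n, p) :=
  - (hess_xy z *m Hinv z) + d3xyy z (Hinv z *m grad_y z) *m Hinv z.
Definition JAy (z : 'cV[R]_n * 'cV[R]_p) : 'M[R]_p :=
  d3yyy z (Hinv z *m grad_y z) *m Hinv z.
End Derivs.

Definition hfun (f g : 'cV[R]_n * 'cV[R]_p -> R) (beta : R)
  (z : 'cV[R]_n * 'cV[R]_p) : R :=
  f (z.1, Amap g z) + beta / 2 * enorm (grad_y g z) ^+ 2.

Definition Dh (Df : 'cV[R]_n * 'cV[R]_p -> set ('cV[R]_n * 'cV[R]_p))
  (g : 'cV[R]_n * 'cV[R]_p -> R) (beta : R) (z : 'cV[R]_n * 'cV[R]_p) :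
  set ('cV[R]_n * 'cV[R]_p) :=
  [set (d.1 + JAx g z *m d.2 + beta *: (hess_xy g z *m grad_y g z),
        JAy g z *m d.2 + beta *: (hess_yy g z *m grad_y g z))
     | d in Df (z.1, Amap g z)].

Definition assumption_A1 (f g : 'cV[R]_n * 'cV[R]_p -> R) (Mf mu Lg Qg : R) :=
  (0 < Mf /\ 0 < mu /\ 0 < Lg /\ 0 < Qg) /\
   (forall z1 z2, `|f z1 - f z2| <= Mf * pnorm (z1 - z2)) /\
   (forall z, differentiable g z /\
              differentiable (fun w => (grad_x g w, grad_y g w)) z) /\
   (forall z (v : 'cV[R]_p), mu * dotv v v <= dotv v (hess_yy g z *m v)) /\
   (forall z1 z2, pnorm ((grad_x g z1, grad_y g z1) - (grad_x g z2, grad_y g z2))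
                    <= Lg * pnorm (z1 - z2)) /\
   (forall z1 z2 (v : 'cV[R]_p),
       enorm ((hess_yy g z1 - hess_yy g z2) *m v) <= Qg * pnorm (z1 - z2) * enorm v) /\
   (forall z1 z2 (v : 'cV[R]_p),
       enorm ((hess_xy g z1 - hess_xy g z2) *m v) <= Qg * pnorm (z1 - z2) * enorm v) /\
   (forall z, differentiable (hess_yy g) z) /\
   (forall v, continuous (fun z => derive (hess_yy g) z v)).

Definition abs_cont_curve (gamma : R -> 'cV[R]_n * 'cV[R]_p) :=
  forall e : R, 0 < e -> exists2 d : R, 0 < d &
    forall (k : nat) (a b : 'I_k -> R),
      (forall i, 0 <= a i /\ a i <= b i /\ b i <= 1) ->
      (forall i j, i != j -> b i <= a j \/ b j <= a i) ->
      \sum_i (b i - a i) < d ->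
      \sum_i pnorm (gamma (b i) - gamma (a i)) < e.

Definition field_integrand (D : 'cV[R]_n * 'cV[R]_p -> set ('cV[R]_n * 'cV[R]_p))
  (gamma : R -> 'cV[R]_n * 'cV[R]_p) (t : R) : \bar R :=
  ereal_sup [set (pdot (derive1 gamma t) v)%:E | v in D (gamma t)].

Definition field_integral (D : 'cV[R]_n * 'cV[R]_p -> set ('cV[R]_n * 'cV[R]_p))
  (gamma : R -> 'cV[R]_n * 'cV[R]_p) : \bar R :=
  (\int[@lebesgue_measure R]_(t in `[0%R, 1%R]) field_integrand D gamma t)%E.

Definition closed_graph (D : 'cV[R]_n * 'cV[R]_p -> set ('cV[R]_n * 'cV[R]_p)) :=
  closed [set zw : ('cV[R]_n * 'cV[R]_p) * ('cV[R]_n * 'cV[R]_p) | D zw.1 zw.2].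

Definition conservative_field (D : 'cV[R]_n * 'cV[R]_p -> set ('cV[R]_n * 'cV[R]_p)) :=
  [/\ closed_graph D,
      (forall z, D z !=set0 /\ compact (D z)) &
      (forall gamma, abs_cont_curve gamma -> gamma 0 = gamma 1 ->
         field_integral D gamma = 0%E)].

Definition is_potential (f : 'cV[R]_n * 'cV[R]_p -> R)
  (D : 'cV[R]_n * 'cV[R]_p -> set ('cV[R]_n * 'cV[R]_p)) :=
  forall gamma, abs_cont_curve gamma ->
    ((f (gamma 1) - f (gamma 0))%:E = field_integral D gamma)%E.

Definition convex_values (D : 'cV[R]_n * 'cV[R]_p -> set ('cV[R]_n * 'cV[R]_p)) :=
  forall z, convex_set (D z : set (convex_lmodType ('cV[R]_n * 'cV[R]_p)%type)).

Definition assumption_A2 (f : 'cV[R]_n * 'cV[R]_p -> R)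
  (Df : 'cV[R]_n * 'cV[R]_p -> set ('cV[R]_n * 'cV[R]_p)) (Mf : R) :=
  [/\ conservative_field Df, is_potential f Df, convex_values Df &
      (forall z v, Df z v -> pnorm v <= Mf)].

(* distance from a point to a set (+oo for the empty set) *)
Definition dist_set (v : 'cV[R]_n * 'cV[R]_p) (S : set ('cV[R]_n * 'cV[R]_p)) : \bar R :=
  ereal_inf [set (pnorm (v - w))%:E | w in S].

End Defs.

(* Main.v *)
Require Import Defs.
From HB Require Import structures.
From mathcomp Require Import all_boot all_order all_algebra.
From mathcomp Require Import all_classical all_reals all_analysis.
From mathcomp Require Import ring lra zify.
Import Order.TTheory GRing.Theory Num.Theory.
Import numFieldNormedType.Exports.
Local Open Scope classical_set_scope.
Local Open Scope ring_scope.
Set Implicit Arguments.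
Unset Strict Implicit.
Unset Printing Implicit Defensive.

(** The averaging condition (d), applied to all subsequences at once, forces the
    directions [u_k] to be bounded and every cluster point of [(z_k, u_k)] to lie
    in the graph of [D]. Removing the convergent noise gives [w_{k+1} = w_k -
    eta_k u_k] with [w_k - z_k -> 0]. Limits of the time-shifted iterates along an
    ultrafilter form a Lipschitz curve [zeta] whose backward difference quotients
    are, by convexity, close to [D (zeta t)]; hence the time-reversed curve
    [sigma] has [sigma' \in D (sigma)] almost everywhere.

    The potential property of [f], applied to the Lipschitz curve
    [(sigma_1, A sigma)], expresses the increment of [h] along [sigma] as the
    integral of [sup_{d \in D_h} <d, sigma'>], which by (f) is at least
    [delta |sigma'|^2 >= delta (2 <a, sigma'> - |a|^2)] for every fixed [a]; the
    right-hand side is a derivative. So [h] decreases strictly along [zeta] for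
    small times unless [0 \in D (zeta 0)]. If the values [h (w_k)] oscillated,
    one could start [zeta] at the last passage below a level [c] which is not a
    critical value before the values climb above [b > c]; the iterates stay above
    [c] for a time bounded below, which contradicts the decrease. *)

(** * Lipschitz functions of a real variable *)

(** Why time is reversed: [zeta] moves with velocity [-w], [w] in [D], while (f) bounds from below a
    supremum of products with [+w]. The field integral is also a supremum over the field, so a
    usable lower bound needs the velocity [+w]. The integrand of the field comes without
    measurability, so the argument never integrates [|sigma'|^2]. After linearization the minorant
    is the derivative of a Lipschitz function, whose integral is an increment. Taking for [a] the
    mean velocity over a duration [T] yields a decrease of at least
    [delta * |sigma 1 - sigma 0|^2 / T]. The chain rule for [Amap] meets two obstacles. [hess_xy] is
    only Lipschitz, so the existence of [d3xyy] must come out of a Schwarz theorem. And the matrix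
    inverse is never differentiated: an exact identity for differences of Newton steps needs only a
    uniform bound on [Hinv]. An ultrafilter gives limits at all real times at once, without
    equicontinuity or diagonal extraction; a genuine subsequence is built only where (d) has to be
    applied. *)

Definition lipschitz_with (R : realType) (V W : normedModType R) (L : R)
  (F : V -> W) := forall s t, `|F s - F t| <= L * `|s - t|.

Lemma lipschitz_with_continuous (R : realType) (V W : normedModType R) (L : R)
  (F : V -> W) : lipschitz_with L F -> continuous F.
Proof.
move=> FL t; apply/cvgrPdist_lt => e e0.
have d0 : 0 < e / (`|L| + 1) by rewrite divr_gt0// ltr_wpDl.
near=> s; apply: (le_lt_trans (FL _ _)).
have : `|t - s| < e / (`|L| + 1).
  by near: s; exact: (@cvgr_dist_lt _ _ _ _ _ id _ cvg_id).
rewrite ltr_pdivlMr ?ltr_wpDl// => H.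
apply: le_lt_trans H; rewrite mulrC ler_wpM2l//.
by rewrite (le_trans (ler_norm _))// lerDl.
Unshelve. all: by end_near. Qed.

Section lipschitz_ftc.
Context {R : realType}.
Notation mu := (@lebesgue_measure R).
Local Open Scope ereal_scope.

(** Both measures come from the same half-open covers, and on each interval the [F]-length is at
    most [L] times the length. A cover of length at most [e / (L + 1)] has [F]-length at most [e];
    the added 1 allows [L = 0]. *)
Lemma stieltjes_dominated (F : cumulative R R) (L : R) : (0 <= L)%R ->
  (forall s t, s <= t -> F t - F s <= L * (t - s))%R ->
  lebesgue_stieltjes_measure F `<< mu.
Proof.
move=> L0 FL; apply/null_content_dominatesP => A mA muA.
apply/eqP; rewrite eq_le measure_ge0 andbT.
apply/lee_addgt0Pr => e e0; rewrite add0e.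
have e1 : (0 < e / (L + 1))%R by rewrite divr_gt0// ltr_wpDl.
have : mu A \is a fin_num by rewrite muA.
move/lb_ereal_inf_adherent => /(_ _ e1)[_/= [B AB] <-].
rewrite -[ereal_inf _]/(mu A) muA add0e => sB.
apply: (@le_trans _ _ (\sum_(0 <= k <oo) wlength F (B k))).
  by apply: ereal_inf_lbound; exists B.
apply: (@le_trans _ _ (\sum_(0 <= k <oo) L%:E * wlength idfun (B k))).
  apply: lee_nneseries => [k _ _|k _]; first by rewrite (wlength_ge0 F).
  have [/(_ k) [/= [a b] _ <-] _] := AB.
  have [ab|ba] := ltP a b; last first.
    by rewrite !set_itv_ge ?bnd_simp -?leNgt// !wlength0 mule0.
  have ab1 := ltW ab; rewrite !wlength_itv_bnd//= -EFinM lee_fin; exact: FL.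
rewrite nneseriesZl//.
apply: (@le_trans _ _ (L%:E * (e / (L + 1))%:E)).
  by apply: lee_pmul => //; [apply: nneseries_ge0 => k _ _; rewrite (wlength_ge0 idfun)|exact: ltW].
rewrite -EFinM lee_fin mulrA ler_pdivrMr ?ltr_wpDl// mulrC ler_wpM2l//; first exact: ltW.
by rewrite lerDl.
Qed.

(** [rho] is the Radon-Nikodym density of the Stieltjes measure of [F] on []0, 1]], where that
    measure is finite. Lebesgue differentiation identifies it with the derivative almost
    everywhere. *)
Lemma nondecreasing_lipschitz_ftc (F : R -> R) (L : R) :
  {homo F : s t / (s <= t)%R} -> lipschitz_with L F ->
  exists rho : R -> R, [/\ mu.-integrable `[0%R, 1%R] (EFin \o rho),
    {ae mu, forall t : R, (0 < t < 1)%R -> is_derive t (1%R : R) F (rho t)} &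
    \int[mu]_(t in `[0%R, 1%R]) (rho t)%:E = (F 1 - F 0)%:E].
Proof.
move=> ndF FL.
have L0 : (0 <= L)%R.
  have := FL 1%R 0%R; rewrite subr0 normr1 mulr1; exact: le_trans.
pose cF : cumulative R R := HB.pack F
  (isCumulative.Build R _ R F ndF (right_continuousW (lipschitz_with_continuous FL))).
pose D := `]0%R, 1%R]%classic : set (measurableTypeR R).
have mD : measurable D by exact: measurable_itv.
pose nu0 := lebesgue_stieltjes_measure cF.
have nuE a b : (a <= b)%R -> nu0 `]a, b]%classic = (F b - F a)%:E.
  move=> ab; rewrite /nu0 /lebesgue_stieltjes_measure /measure_extension.
  by rewrite measurable_mu_extE /= ?wlength_itv_bnd//; exists (a, b).
have nuDoo : nu0 D < +oo by rewrite /D nuE// ltry.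
pose nu := charge_of_finite_measure (mfrestr mD nuDoo).
have numu : nu `<< mu.
  apply/null_content_dominatesP => A mA muA.
  rewrite /nu /= /mfrestr /mrestr.
  have dom : nu0 `<< mu.
    apply: (@stieltjes_dominated cF L) => // s t st.
    have := FL t s; rewrite (ger0_norm (_ : 0 <= F t - F s)%R) ?subr_ge0 ?ndF//.
    by rewrite ger0_norm// subr_ge0.
  move/null_content_dominatesP : dom; apply => //; first exact: measurableI.
  by apply/eqP; rewrite -measure_le0 -muA measureIl.
pose rho t := fine (Radon_Nikodym nu mu t).
have rhoE : EFin \o rho = Radon_Nikodym nu mu.
  by apply/funext => t /=; rewrite fineK// Radon_Nikodym_fin_num.
have irho : mu.-integrable setT (EFin \o rho).
  by rewrite rhoE; exact: Radon_Nikodym_integrable.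
have intE y : (0 <= y <= 1)%R -> \int[mu]_(t in `]0%R, y]) (rho t)%:E = (F y - F 0)%:E.
  move=> /andP[y0 y1].
  have -> : (fun t => (rho t)%:E) = Radon_Nikodym nu mu by exact: rhoE.
  rewrite -Radon_Nikodym_integral//= /mfrestr /mrestr setIidl; last first.
    by move=> t; rewrite /D /= !in_itv/= => /andP[-> /le_trans]; apply.
  by rewrite [LHS]nuE.
exists rho; split.
- exact: integrableS irho.
- have intf y : mu.-integrable [set` Interval (BRight 0%R) (BRight y)] (EFin \o rho).
    exact: integrableS irho.
  have := FTC1 intf (open_integrable_locally openT irho).
  apply: filterS; first exact: (ae_filter_ringOfSetsType mu).
  move=> t Ht /andP[t0 t1].
  have [//|dF dFE] := Ht.
  apply: (@near_eq_is_derive R R R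
    (fun y : R => (\int[mu]_(s in `]0%R, y]) (rho s))%R + F 0)%R F t 1%R (rho t)).
  + near=> y; rewrite /Rintegral intE /= ?subrK//.
    by apply/andP; split; apply: ltW; near: y; [exact: lt_nbhsr|exact: lt_nbhsl].
  + rewrite -[X in is_derive _ _ _ X]addr0; apply: is_deriveD.
    by apply: DeriveDef; [exact: dF|rewrite -derive1E].
- rewrite -[RHS](intE 1%R) ?ler01 ?lexx//.
  rewrite integral_itv_obnd_cbnd//.
  by apply: (measurable_funS measurableT) => //; exact: measurable_int irho.
Unshelve. all: by end_near. Qed.
End lipschitz_ftc.

Section lipschitz_ftc2.
Context {R : realType}.
Notation mu := (@lebesgue_measure R).
Local Open Scope ereal_scope.

(** [G t + L * t] is nondecreasing; the linear term is subtracted again at the end. *)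
Lemma lipschitz_ftc (G : R -> R) (L : R) : lipschitz_with L G ->
  exists rho : R -> R, [/\ mu.-integrable `[0%R, 1%R] (EFin \o rho),
    {ae mu, forall t : R, (0 < t < 1)%R -> is_derive t (1%R : R) G (rho t)} &
    \int[mu]_(t in `[0%R, 1%R]) (rho t)%:E = (G 1 - G 0)%:E].
Proof.
move=> GL.
have L0 : (0 <= L)%R.
  have := GL 1%R 0%R; rewrite subr0 normr1 mulr1; exact: le_trans.
pose F t := (G t + L * t)%R.
have ndF : {homo F : s t / (s <= t)%R}.
  move=> s t st; rewrite /F; have := GL s t.
  rewrite [X in (_ * X)%R]distrC (ger0_norm (_ : 0 <= t - s)%R) ?subr_ge0//.
  move=> /(le_trans (ler_norm _)).
  lra.
have FL : lipschitz_with (L + L) F.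
  move=> s t; rewrite /F (_ : _ - _ = (G s - G t) + L * (s - t))%R; last by ring.
  by rewrite (le_trans (ler_normD _ _))// mulrDl lerD// normrM ger0_norm.
have [rho [irho drho intrho]] := nondecreasing_lipschitz_ftc ndF FL.
have icst : mu.-integrable `[0%R, 1%R] (EFin \o cst L).
  apply: continuous_compact_integrable; first exact: segment_compact.
  by apply: continuous_subspaceT => x; exact: cvg_cst.
exists (fun t => rho t - L)%R; split.
- have m01 : measurable (`[0%R, 1%R]%classic : set (measurableTypeR R)) by exact: measurable_itv.
  by have H := integrableB m01 irho icst; apply: (eq_integrable m01) H.
- apply: filterS drho; first exact: (ae_filter_ringOfSetsType mu).
  move=> t Ht /Ht {}Ht.
  have dL : is_derive t (1%R : R) (L *: id : R -> R)%R L.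
    by rewrite -[X in is_derive _ _ _ X](mulr1 L); exact: is_deriveZ.
  have := is_deriveB Ht dL; congr is_derive.
  by apply/funext => s; rewrite /F !fctE /= addrK.
- under eq_integral do rewrite EFinB.
  rewrite integralB_EFin// intrho integral_cst//.
  have -> : forall x : \bar R, x = 1 -> L%:E * x = L%:E by move=> x ->; rewrite mule1.
    rewrite -EFinB /F; congr (_%:E); ring.
  by rewrite [LHS]lebesgue_measure_itv/= lte_fin ltr01 -EFinB subr0.
Qed.

(* The integral is a difference of suprema over simple functions, so it is
   monotone even on functions that are not measurable. *)
Lemma le_integral_nomeas d (T : measurableType d) (m : {measure set T -> \bar R})
    (D : set T) (f g : T -> \bar R) : (forall x, D x -> f x <= g x) ->
  \int[m]_(x in D) f x <= \int[m]_(x in D) g x.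
Proof.
move=> fg.
have fgD x : (f \_ D) x <= (g \_ D) x.
  by rewrite !patchE; case: ifPn => // /set_mem; exact: fg.
rewrite /integral; apply: leeB; apply: le_ereal_sup => _ /= [h hle <-];
  exists h => // x; apply: (le_trans (hle x)); rewrite ?funeposE ?funenegE.
- by rewrite ge_max le_max fgD /= le_max lexx orbT.
- by rewrite ge_max le_max leeN2 fgD /= le_max lexx orbT.
Qed.

(** [m] will be the integrand of a conservative field. Integrals of such functions are compared
    through a pointwise inequality, so the crude bound [K] is asked everywhere while the derivative
    is controlled off a null set. *)
Lemma integral_ge_lipschitz (G : R -> R) (L K : R) (m : R -> \bar R) :
  lipschitz_with L G -> (forall t, K%:E <= m t) ->
  {ae mu, forall t : R, (0 < t < 1)%R -> derivable G t (1%R : R) ->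
     ('D_1 G t)%:E <= m t} ->
  (G 1 - G 0)%:E <= \int[mu]_(t in `[0%R, 1%R]) m t.
Proof.
move=> GL Km aem.
have [rho [irho drho <-]] := lipschitz_ftc GL.
have : {ae mu, forall t : R, (0 < t < 1)%R -> (rho t)%:E <= m t}.
  apply: (@filterS2 _ _ (ae_filter_ringOfSetsType mu) _ _ _ _ drho aem).
  move=> t Hr Hm t01; have [dG <-] := Hr t01; exact: Hm.
case=> N [mN muN subN].
pose N1 := N `|` [set 0%R] `|` [set 1%R].
have mN1 : measurable N1 by do 2 apply: measurableU => //.
have muN1 : mu N1 = 0.
  rewrite /N1 measureU0//; [|exact: measurableU|exact: lebesgue_measure_set1].
  by rewrite measureU0//; exact: lebesgue_measure_set1.
(* Setting the density to [K] on [N1] keeps its integral and makes the inequality with [m] true at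
   every point. [N1] contains the endpoints because the derivative is controlled on the open
   interval only. *)
rewrite [leLHS](ae_eq_integral (fun t => if t \in N1 then K%:E else (rho t)%:E)) //.
- apply: le_integral_nomeas => t; rewrite /= in_itv/= => /andP[t0 t1].
  case: ifPn => // /negP tN.
  apply: contrapT => Hm; apply: tN; rewrite inE.
  have [->|tn0] := eqVneq t 0%R; first by left; right.
  have [->|tn1] := eqVneq t 1%R; first by right.
  left; left; apply: subN => /= Hm'; apply: Hm; apply: Hm'.
  by rewrite !lt_neqAle eq_sym tn0 t0 tn1 t1.
- exact: measurable_int irho.
- apply: measurable_fun_if => //.
  + apply: (measurable_fun_bool true) => //.
    rewrite (_ : _ @^-1` _ = N1); first exact: measurableI.
    by apply/seteqP; split => t /=; [move/set_mem|move/mem_set].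
  + apply: (measurable_funS _ _ (measurable_int _ irho)) => //.
- exists N1; split => // t /=; apply: contra_notP => tN _.
  by rewrite ifN//; apply/negP => /set_mem.
Qed.
End lipschitz_ftc2.

(** * Mixed derivatives *)

Lemma is_derive_line (R : realType) (V W : normedModType R) (F : V -> W) (z v : V)
    (s : R) : derivable F (s *: v + z) v ->
  is_derive s (1 : R) (fun t : R => F (t *: v + z)) ('D_v F (s *: v + z)).
Proof.
move=> dF.
have E : (fun h : R => h^-1 *: (((fun t : R => F (t *: v + z)) \o shift s) (h *: (1 : R))
      - F (s *: v + z))) =
    (fun h : R => h^-1 *: ((F \o shift (s *: v + z)) (h *: v) - F (s *: v + z))).
  apply/funext => h /=; congr (_ *: (F _ - _)).
  by rewrite [h *: 1]mulr1 scalerDl addrA.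
by apply: DeriveDef; rewrite /derivable /derive E.
Qed.

Lemma mvt_line (R : realType) (V : normedModType R) (F : V -> R) (z v : V) (t : R) :
  (forall w, derivable F w v) ->
  exists th : R, `|th| <= `|t| /\ F (t *: v + z) - F z = t * 'D_v F (th *: v + z).
Proof.
move=> dF; pose k s := F (s *: v + z).
have dk s : is_derive s (1 : R) k ('D_v F (s *: v + z)) by exact: is_derive_line.
have ck : continuous k.
  by move=> s; apply: differentiable_continuous; apply/derivable1_diffP; have [] := dk s.
have k0 : F z = k 0 by rewrite /k scale0r add0r.
have [t0|t0] := leP 0 t.
  have [c cin Hc] := MVT_segment t0 (fun s _ => dk s) (continuous_subspaceT ck).
  exists c; split; last by rewrite k0 [F _ - _]Hc subr0 mulrC.
  by move: cin; rewrite in_itv/= => /andP[c0 ct]; rewrite !ger0_norm// (le_trans c0).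
have [c cin Hc] := MVT_segment (ltW t0) (fun s _ => dk s) (continuous_subspaceT ck).
exists c; split; last first.
  by rewrite k0 -/(k t) -opprB Hc sub0r mulrN opprK mulrC.
move: cin; rewrite in_itv/= => /andP[ct c0].
by rewrite !ler0_norm ?lerN2// ltW.
Qed.

(* Peano's form of Schwarz' theorem: the existence of the second mixed derivative
   is part of the conclusion, because [hess_xy] is not assumed differentiable. *)
Lemma mixed_derive_swap (R : realType) (V : normedModType R) (G : V -> R) (u v z : V) :
  (forall w, derivable G w u) -> (forall w, derivable G w v) ->
  (forall w, derivable ('D_v G) w u) -> {for z, continuous ('D_u ('D_v G))} ->
  is_derive z v ('D_u G) ('D_u ('D_v G) z).
Proof.
move=> dGu dGv dGvu cz.
set psi := 'D_u ('D_v G) in cz *.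
suff H : h^-1 *: (('D_u G \o shift z) (h *: v) - 'D_u G z) @[h --> 0^'] --> psi z.
  apply: DeriveDef; first by apply/cvg_ex; exists (psi z).
  exact/cvg_lim.
apply/cvgrPdist_le => e e0.
have [r r0 Hr] : exists2 r : R, 0 < r & forall s t : R, `|s| < r -> `|t| < r ->
    `|psi z - psi (s *: u + (t *: v + z))| <= e.
  have /cvgrPdist_le/(_ _ e0)/nbhs_ballP[r r0 Hr] := cz.
  have N0 : 0 < `|u| + `|v| + 1 by rewrite ltr_wpDl// addr_ge0.
  exists (r / (`|u| + `|v| + 1)); first by rewrite divr_gt0.
  move=> s t; rewrite !ltr_pdivlMr// => hs ht; apply: Hr.
  rewrite -ball_normE /ball_/= addrA opprD addrCA subrr addr0 normrN.
  apply: (le_lt_trans (ler_normD _ _)); rewrite !normrZ.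
  have := normr_ge0 s; have := normr_ge0 t; have := normr_ge0 u; have := normr_ge0 v.
  have [st|ts] := leP `|s| `|t|.
    nra.
  nra.
near=> h.
have h0 : h != 0 by near: h; exact: nbhs_dnbhs_neq.
have hr : `|h| < r by near: h; exact: dnbhs0_lt.
(* For fixed [h], the increment of ['D_u G] is a limit of second-order differences as [s] tends to
   0, so it suffices to bound these. *)
have Q : (s^-1 * (G (s *: u + (h *: v + z)) - G (h *: v + z)) -
    s^-1 * (G (s *: u + z) - G z)) @[s --> 0^'] --> 'D_u G (h *: v + z) - 'D_u G z.
  by apply: cvgB; [exact: (dGu (h *: v + z))|exact: (dGu z)].
have /= : (h^-1 * (s^-1 * (G (s *: u + (h *: v + z)) - G (h *: v + z)) -
    s^-1 * (G (s *: u + z) - G z))) @[s --> 0^'] --> h^-1 * ('D_u G (h *: v + z) - 'D_u G z).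
  by apply: cvgM Q; exact: cvg_cst.
move/(cvgB (cvg_cst (psi z)))/cvg_norm/cvgr_to_le; apply.
near=> s.
have s0 : s != 0 by near: s; exact: nbhs_dnbhs_neq.
have sr : `|s| < r by near: s; exact: dnbhs0_lt.
(* The second-order difference is an increment of [K] along [v]. The mean value theorem in direction
   [v], then in direction [u], turns it into a value of [psi] near [z]. *)
pose K w := G (s *: u + w) - G w.
have dsh w : is_derive w v (fun w => G (s *: u + w)) ('D_v G (s *: u + w)).
  have := dGv (s *: u + w).
  have E : (fun h : R => h^-1 *: (((fun w => G (s *: u + w)) \o shift w) (h *: v)
      - G (s *: u + w))) =
    (fun h : R => h^-1 *: ((G \o shift (s *: u + w)) (h *: v) - G (s *: u + w))).
    by apply/funext => k /=; rewrite addrCA.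
  by move=> ?; apply: DeriveDef; rewrite /derivable /derive E.
have dK w : is_derive w v K ('D_v G (s *: u + w) - 'D_v G w).
  exact: is_deriveB (dsh w) (derivableP (dGv w)).
have [th [thh HK]] := mvt_line z h (fun w => @ex_derive _ _ _ _ _ _ _ (dK w)).
have [th' [ths HG]] := mvt_line (th *: v + z) s dGvu.
rewrite ?fctE /=.
rewrite (_ : h^-1 * _ = psi (th' *: u + (th *: v + z))).
  by apply: Hr; apply: le_lt_trans; eassumption.
rewrite -mulrBr (_ : _ - _ - _ = K (h *: v + z) - K z) // HK.
rewrite (_ : 'D_v K _ = 'D_v G (s *: u + (th *: v + z)) - 'D_v G (th *: v + z)); last first.
  exact: derive_val.
by rewrite HG [s^-1 * _]mulrCA !mulKf.
Unshelve. all: by end_near. Qed.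

(** * Euclidean and supremum norms *)

Section euclid.
Context {R : realType}.

Lemma dotvE (m : nat) (u v : 'cV[R]_m) : dotv u v = (u^T *m v) 0 0.
Proof. by rewrite mxE; apply: eq_bigr => i _; rewrite mxE. Qed.

Lemma dotvC (m : nat) (u v : 'cV[R]_m) : dotv u v = dotv v u.
Proof. by apply: eq_bigr => i _; rewrite mulrC. Qed.

Lemma dotvDr (m : nat) (u v w : 'cV[R]_m) : dotv u (v + w) = dotv u v + dotv u w.
Proof. by rewrite !dotvE mulmxDr mxE. Qed.

Lemma dotvZr (m : nat) (u v : 'cV[R]_m) (a : R) : dotv u (a *: v) = a * dotv u v.
Proof. by rewrite !dotvE -scalemxAr mxE. Qed.

Lemma dotvDl (m : nat) (u v w : 'cV[R]_m) : dotv (u + v) w = dotv u w + dotv v w.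
Proof. by rewrite !(dotvC _ w) dotvDr. Qed.

Lemma dotvZl (m : nat) (u v : 'cV[R]_m) (a : R) : dotv (a *: u) v = a * dotv u v.
Proof. by rewrite !(dotvC _ v) dotvZr. Qed.

Lemma dotv_mulmx (m k : nat) (A : 'M[R]_(m, k)) (u : 'cV[R]_m) (v : 'cV[R]_k) :
  dotv (A *m v) u = dotv v (A^T *m u).
Proof. by rewrite !dotvE trmx_mul mulmxA. Qed.

Lemma dotv_ge0 (m : nat) (u : 'cV[R]_m) : 0 <= dotv u u.
Proof. by apply: sumr_ge0 => i _; rewrite -expr2 sqr_ge0. Qed.

Lemma dotv_eq0 (m : nat) (u : 'cV[R]_m) : dotv u u = 0 -> u = 0.
Proof.
move=> /eqP; rewrite psumr_eq0; last by move=> i _; rewrite -expr2 sqr_ge0.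
move=> /allP H; apply/colP => i; rewrite mxE.
by have := H i (mem_index_enum _); rewrite /= mulf_eq0 orbb => /eqP.
Qed.

Lemma norm_coord_le (m k : nat) (M : 'M[R]_(m, k)) i j : `|M i j| <= `|M|.
Proof.
rewrite [leRHS]/Num.Def.normr/= mx_normrE.
exact: (le_bigmax _ (fun ij : 'I_m * 'I_k => `|M ij.1 ij.2|) (i, j)).
Qed.

Lemma mx_norm_le (m k : nat) (M : 'M[R]_(m, k)) (c : R) : 0 <= c ->
  (forall i j, `|M i j| <= c) -> `|M| <= c.
Proof.
by move=> c0 H; rewrite [leLHS]/Num.Def.normr/= mx_normrE; apply: bigmax_le.
Qed.

(** Topology and Lipschitz bounds use the supremum norm, the assumptions the Euclidean one. Only
    their equivalence matters, so a dimension factor stands in for Cauchy-Schwarz. *)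
Lemma dotv_le (m : nat) (u v : 'cV[R]_m) : `|dotv u v| <= m%:R * (`|u| * `|v|).
Proof.
rewrite (le_trans (ler_norm_sum _ _ _))//.
rewrite mulr_natl -[X in _ *+ X](card_ord m) -sumr_const.
by apply: ler_sum => i _; rewrite normrM ler_pM ?norm_coord_le.
Qed.

Lemma norm_le_enorm (m : nat) (u : 'cV[R]_m) : `|u| <= enorm u.
Proof.
apply: mx_norm_le; first exact: sqrtr_ge0.
move=> i j; rewrite ord1 -sqrtr_sqr ler_wsqrtr// expr2 /dotv.
rewrite (bigD1 i)//= lerDl; apply: sumr_ge0 => k _.
by rewrite -expr2 sqr_ge0.
Qed.

Lemma enorm_le (m : nat) (u : 'cV[R]_m) : enorm u <= m%:R * `|u|.
Proof.
rewrite -[leRHS]ger0_norm ?mulr_ge0// -sqrtr_sqr ler_wsqrtr//.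
rewrite (le_trans (ler_norm _))// (le_trans (dotv_le _ _))//.
rewrite exprMn -expr2.
case: m u => [|m] u; first by rewrite !mul0r expr0n mul0r.
rewrite ler_wpM2r ?sqr_ge0//.
by rewrite expr2 -natrM ler_nat leq_pmulr.
Qed.

Lemma enorm_sqr (m : nat) (u : 'cV[R]_m) : enorm u ^+ 2 = dotv u u.
Proof. by rewrite sqr_sqrtr ?dotv_ge0. Qed.

Context {n p : nat}.
Local Notation Z := ('cV[R]_n * 'cV[R]_p)%type.

Lemma pdot_ge0 (a : Z) : 0 <= pdot a a.
Proof. by rewrite addr_ge0 ?dotv_ge0. Qed.

Lemma norm_fst_le (a : Z) : `|a.1| <= `|a|.
Proof. by rewrite [leRHS]/Num.Def.normr /= le_max lexx. Qed.

Lemma norm_snd_le (a : Z) : `|a.2| <= `|a|.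
Proof. by rewrite [leRHS]/Num.Def.normr /= le_max lexx orbT. Qed.

Lemma norm_pair_le (a : Z) (c : R) : `|a.1| <= c -> `|a.2| <= c -> `|a| <= c.
Proof. by move=> h1 h2; rewrite [leLHS]/Num.Def.normr /= ge_max h1. Qed.

Lemma pdot_le (a b : Z) : `|pdot a b| <= (n + p)%:R * (`|a| * `|b|).
Proof.
rewrite (le_trans (ler_normD _ _))// natrD mulrDl lerD//.
  by rewrite (le_trans (dotv_le _ _))// ler_wpM2l// ler_pM ?norm_fst_le.
by rewrite (le_trans (dotv_le _ _))// ler_wpM2l// ler_pM ?norm_snd_le.
Qed.

Lemma norm_le_pnorm (a : Z) : `|a| <= pnorm a.
Proof.
apply: norm_pair_le.
  by rewrite (le_trans (norm_le_enorm _))// ler_wsqrtr// lerDl dotv_ge0.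
by rewrite (le_trans (norm_le_enorm _))// ler_wsqrtr// lerDr dotv_ge0.
Qed.

Lemma pnorm_le (a : Z) : pnorm a <= (n + p)%:R * `|a|.
Proof.
rewrite -[leRHS]ger0_norm ?mulr_ge0// -sqrtr_sqr ler_wsqrtr//.
rewrite (le_trans (ler_norm _))// (le_trans (pdot_le _ _))//.
rewrite exprMn -expr2; case: (n + p)%N => [|k]; first by rewrite !mul0r expr0n mul0r.
by rewrite ler_wpM2r ?sqr_ge0// expr2 -natrM ler_nat leq_pmulr.
Qed.

Lemma pnorm_ge0 (a : Z) : 0 <= pnorm a. Proof. exact: sqrtr_ge0. Qed.

Lemma pnorm_sqr (a : Z) : pnorm a ^+ 2 = pdot a a.
Proof. by rewrite sqr_sqrtr ?pdot_ge0. Qed.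

Lemma pdotC (a b : Z) : pdot a b = pdot b a.
Proof. by rewrite /pdot !(dotvC a.1) !(dotvC a.2). Qed.

Lemma pdotDr (a b c : Z) : pdot a (b + c) = pdot a b + pdot a c.
Proof. by rewrite /pdot !dotvDr addrACA. Qed.

Lemma pdotZr (a b : Z) (k : R) : pdot a (k *: b) = k * pdot a b.
Proof. by rewrite /pdot !dotvZr mulrDr. Qed.

Lemma pdotBr (a b c : Z) : pdot a (b - c) = pdot a b - pdot a c.
Proof. by rewrite pdotDr -scaleN1r pdotZr mulN1r. Qed.

(* From [0 <= |w - a|^2], which linearizes the quadratic lower bound of (f). *)
Lemma pdot_young (w a : Z) : 2 * pdot a w - pdot a a <= pdot w w.
Proof.
have := pdot_ge0 (w - a).
rewrite pdotBr !(pdotC (w - a)) !pdotBr (pdotC w a); lra.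
Qed.

Lemma pdot_gt0 (a : Z) : a != 0 -> 0 < pdot a a.
Proof.
move=> a0; rewrite lt_neqAle pdot_ge0 andbT eq_sym; apply: contra a0.
rewrite paddr_eq0 ?dotv_ge0// => /andP[/eqP/dotv_eq0 a1 /eqP/dotv_eq0 a2].
by case: a a1 a2 => /= _ _ -> ->.
Qed.

End euclid.

(** * Derivatives along curves *)

Lemma is_derive_comp_curve (R : realType) (V W : normedModType R) (phi : V -> W)
    (s : R -> V) (t : R) (ds : V) : differentiable phi (s t) ->
  is_derive t (1 : R) s ds -> is_derive t (1 : R) (phi \o s) ('D_ds phi (s t)).
Proof.
move=> dphi [ds1 dsE].
have dfs : differentiable s t by apply/derivable1_diffP.
have dc : differentiable (phi \o s) t by exact: differentiable_comp.
apply: DeriveDef; first by apply: diff_derivable.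
by rewrite deriveE// diff_comp//= -(deriveE _ dfs) dsE deriveE.
Qed.

Lemma is_derive_pair (R : realType) (V W1 W2 : normedModType R) (a : V -> W1)
    (b : V -> W2) (t v : V) (da : W1) (db : W2) :
  is_derive t v a da -> is_derive t v b db ->
  is_derive t v (fun s => (a s, b s)) (da, db).
Proof.
move=> [ha ea] [hb eb].
have H : h^-1 *: (((fun s => (a s, b s)) \o shift t) (h *: v) - (a t, b t))
    @[h --> 0^'] --> (da, db).
  by apply: cvg_pair => /=; [rewrite -ea|rewrite -eb].
by apply: DeriveDef; [apply/cvg_ex; exists (da, db)|exact/cvg_lim].
Qed.

Lemma differentiable_fst (R : realType) (V W : normedModType R) (z : V * W) :
  differentiable (fst : V * W -> V) z.
Proof. by apply: linear_differentiable => x; exact: cvg_fst. Qed.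

Lemma differentiable_snd (R : realType) (V W : normedModType R) (z : V * W) :
  differentiable (snd : V * W -> W) z.
Proof. by apply: linear_differentiable => x; exact: cvg_snd. Qed.

Section pair_directions.
Context {R : realType} {n p : nat}.
Local Notation Z := ('cV[R]_n * 'cV[R]_p)%type.

Lemma pair_sum_basis (v : Z) :
  v = \sum_k v.1 k 0 *: (@ex R n k, 0 : 'cV[R]_p)
    + \sum_k v.2 k 0 *: (0 : 'cV[R]_n, @ey R p k).
Proof.
have sumP m (I : finType) (F : I -> 'cV[R]_m) (G : I -> Z) (e : Z -> 'cV[R]_m) :
   (forall i, e (G i) = F i) -> {morph e : a b / a + b} -> e 0 = 0 -> e (\sum_i G i) = \sum_i F i.
  by move=> H1 H2 H3; rewrite (big_morph e H2 H3); apply: eq_bigr.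
apply/eqP; rewrite -pair_eqE /pair_eq /=; apply/andP; split; apply/eqP.
  rewrite (sumP _ _ (fun k => v.1 k 0 *: ex R k) _ fst)//.
  rewrite (sumP _ _ (fun k => 0) _ fst)//; last by move=> k /=; rewrite scaler0.
  rewrite [X in _ + X]big1// addr0; apply/colP => i; rewrite summxE (bigD1 i)//= !mxE !eqxx mulr1.
  rewrite big1 ?addr0// => j ji; rewrite !mxE eq_sym (negbTE ji) mulr0//.
rewrite (sumP _ _ (fun k => 0) _ snd)//; last by move=> k /=; rewrite scaler0.
rewrite (sumP _ _ (fun k => v.2 k 0 *: ey R k) _ snd)//.
rewrite [X in X + _]big1// add0r; apply/colP => i; rewrite summxE (bigD1 i)//= !mxE !eqxx mulr1.
by rewrite big1 ?addr0// => j ji; rewrite !mxE eq_sym (negbTE ji) mulr0.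
Qed.

Lemma derive_pair_basis (W : normedModType R) (phi : Z -> W) (z v : Z) :
  differentiable phi z ->
  'D_v phi z = \sum_k v.1 k 0 *: 'D_(@ex R n k, 0) phi z
    + \sum_k v.2 k 0 *: 'D_(0, @ey R p k) phi z.
Proof.
move=> dphi; rewrite deriveE// {1}(pair_sum_basis v) linearD !linear_sum.
by congr (_ + _); apply: eq_bigr => k _; rewrite linearZ/= deriveE.
Qed.

End pair_directions.

(** * The Hessian of the lower-level function *)

Section hessian.
Context {R : realType} {n p : nat}.
Local Notation Z := ('cV[R]_n * 'cV[R]_p)%type.
Variables (g : Z -> R) (mu : R).
Hypothesis mu0 : 0 < mu.
Hypothesis dg : forall z, differentiable g z.
Hypothesis dgrad : forall z, differentiable (fun w => (grad_x g w, grad_y g w)) z.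
Hypothesis hess_pos : forall z (v : 'cV[R]_p),
  mu * dotv v v <= dotv v (hess_yy g z *m v).
Hypothesis dhess : forall z, differentiable (hess_yy g) z.
Hypothesis chess : forall v, continuous (fun z => derive (hess_yy g) z v).

Lemma differentiable_grad_y z : differentiable (grad_y g) z.
Proof.
have := differentiable_comp (dgrad z) (differentiable_snd (grad_x g z, grad_y g z)).
by [].
Qed.

Let Gy (j : 'I_p) : Z -> R := fun w => grad_y g w j 0.

Let GyE j : Gy j = 'D_(0, ey R j) g.
Proof. by apply/funext => w; rewrite /Gy mxE. Qed.

Lemma differentiable_grad_y_coord j z : differentiable (fun w => grad_y g w j 0) z.
Proof.
exact: (differentiable_comp (differentiable_grad_y z)
  (differentiable_coord (grad_y g z) j 0)).
Qed.

Lemma differentiable_hess_yy_coord i j z : differentiable (fun w => hess_yy g w i j) z.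
Proof.
exact: (differentiable_comp (dhess z) (differentiable_coord (hess_yy g z) i j)).
Qed.

Lemma hess_yy_symE z i j : hess_yy g z i j = hess_yy g z j i.
Proof.
have H := @mixed_derive_swap R Z g (0, ey R i) (0, ey R j) z.
have D w : 'D_(0, ey R i) ('D_(0, ey R j) g) w = hess_yy g w i j.
  by rewrite -GyE mxE.
have [| | | |_] := H; first by move=> w; exact: diff_derivable.
- by move=> w; exact: diff_derivable.
- move=> w; rewrite -GyE; apply: diff_derivable; exact: differentiable_grad_y_coord.
- have -> : 'D_(0, ey R i) ('D_(0, ey R j) g) = (fun w => hess_yy g w i j).
    by apply/funext => w; rewrite D.
  apply: differentiable_continuous; exact: differentiable_hess_yy_coord.
- by rewrite D => <-; rewrite -GyE mxE.
Qed.

Lemma hess_yy_sym z : (hess_yy g z)^T = hess_yy g z.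
Proof. by apply/matrixP => i j; rewrite mxE hess_yy_symE. Qed.

Lemma derive_hess_yyE z v i j :
  'D_v (hess_yy g) z i j = 'D_v (fun w => hess_yy g w i j) z.
Proof. by rewrite derive_mx ?mxE//; exact: diff_derivable. Qed.

Lemma derive_hess_yy_symE z v i j :
  'D_v (hess_yy g) z i j = 'D_v (hess_yy g) z j i.
Proof.
rewrite !derive_hess_yyE; congr ('D_v _ z).
by apply/funext => w; exact: hess_yy_symE.
Qed.

Lemma derive_grad_y_coordE i (r : 'cV[R]_p) w :
  'D_(0, r) (fun w => grad_y g w i 0) w = \sum_j r j 0 * hess_yy g w j i.
Proof.
rewrite derive_pair_basis; last exact: differentiable_grad_y_coord.
rewrite big1 ?add0r => [|k _]; last by rewrite mxE scale0r.
by apply: eq_bigr => j _; rewrite /= mxE.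
Qed.

(** The swap is applied to a coordinate of [grad_y]: its derivative along [(0, r)] is a combination
    of entries of [hess_yy], which are differentiable with continuous derivatives. This yields the
    existence of [d3xyy] and expresses both third derivatives through that of [hess_yy]. *)
Lemma third_derive_swap z (u : Z) (r : 'cV[R]_p) (i : 'I_p) :
  is_derive z (0, r) ('D_u (fun w => grad_y g w i 0))
    (('D_u (hess_yy g) z *m r) i 0).
Proof.
pose phi (j : 'I_p) : Z -> R := r j 0 *: (fun w => hess_yy g w j i).
have DE : 'D_(0, r) (fun w => grad_y g w i 0) = \sum_j phi j.
  by apply/funext => w; rewrite derive_grad_y_coordE fct_sumE.
have dphi j w v : derivable (phi j) w v.
  by apply: derivableZ; apply: diff_derivable; exact: differentiable_hess_yy_coord.
have DDE w : 'D_u ('D_(0, r) (fun w => grad_y g w i 0)) w =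
    ('D_u (hess_yy g) w *m r) i 0.
  rewrite DE derive_sum// mxE; apply: eq_bigr => j _.
  rewrite deriveZ; last by apply: diff_derivable; exact: differentiable_hess_yy_coord.
  by rewrite -derive_hess_yyE derive_hess_yy_symE mulrC.
rewrite -DDE; apply: mixed_derive_swap.
- by move=> w; apply: diff_derivable; exact: differentiable_grad_y_coord.
- by move=> w; apply: diff_derivable; exact: differentiable_grad_y_coord.
- by move=> w; rewrite DE; apply: derivable_sum.
- have -> : 'D_u ('D_(0, r) (fun w => grad_y g w i 0)) =
      (fun w => \sum_j 'D_u (hess_yy g) w i j * r j 0).
    by apply/funext => w; rewrite DDE mxE.
  apply: cvg_big => [|j _]; first exact: add_continuous.
  apply: cvgM; last exact: cvg_cst.
  apply: (@continuous_comp _ _ _ (fun w => 'D_u (hess_yy g) w) (fun M : 'M[R]_p => M i j)).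
    exact: chess.
  exact: coord_continuous.
Qed.

Lemma d3xyyE z r k i :
  d3xyy g z r k i = ('D_(ex R k, 0) (hess_yy g) z *m r) i 0.
Proof.
have E k' i' : (fun w => hess_xy g w k' i') = 'D_(ex R k', 0) (fun w => grad_y g w i' 0).
  by apply/funext => w; rewrite mxE.
rewrite /d3xyy derive_mx.
  by rewrite [LHS]mxE E; have [_ ->] := third_derive_swap z (ex R k, 0) r i.
apply/derivable_mxP => k' i'; rewrite E.
by have [] := third_derive_swap z (ex R k', 0) r i'.
Qed.

Lemma d3yyyE z r k i :
  d3yyy g z r k i = ('D_(0, ey R k) (hess_yy g) z *m r) i 0.
Proof.
have E k' i' : (fun w => hess_yy g w k' i') = 'D_(0, ey R k') (fun w => grad_y g w i' 0).
  by apply/funext => w; rewrite mxE.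
by rewrite /d3yyy derive_hess_yyE E; have [_ ->] := third_derive_swap z (0, ey R k) r i.
Qed.

Lemma derive_grad_y z v :
  'D_v (grad_y g) z = (hess_xy g z)^T *m v.1 + (hess_yy g z)^T *m v.2.
Proof.
apply/colP => i.
rewrite derive_mx; last exact/diff_derivable/differentiable_grad_y.
rewrite [LHS]mxE derive_pair_basis; last exact: differentiable_grad_y_coord.
rewrite mxE [X in _ = X + _]mxE [X in _ = _ + X]mxE.
by congr (_ + _); apply: eq_bigr => k _; rewrite [in RHS]mxE [X in X * _]mxE mulrC.
Qed.

(** The chain rule for the Newton step produces the left side; [JAx] and [JAy] are written with the
    tensors on the right. *)
Lemma derive_hess_yy_mul z v r :
  'D_v (hess_yy g) z *m r = (d3xyy g z r)^T *m v.1 + (d3yyy g z r)^T *m v.2.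
Proof.
rewrite derive_pair_basis// mulmxDl !mulmx_suml; apply/colP => i.
rewrite [RHS]mxE [X in _ = X + _]mxE [X in _ = _ + X]mxE [LHS]mxE !summxE.
congr (_ + _); apply: eq_bigr => k _.
  by rewrite -scalemxAl [LHS]mxE [X in _ = X * _]mxE d3xyyE mulrC.
by rewrite -scalemxAl [LHS]mxE [X in _ = X * _]mxE d3yyyE mulrC.
Qed.

(** A kernel vector [r] satisfies [mu * dotv r r <= 0]. Symmetry passes from row kernels to the
    columns of the coercivity bound. *)
Lemma hess_yy_unit z : hess_yy g z \in unitmx.
Proof.
rewrite -row_free_unit -kermx_eq0; apply/eqP/row_matrixP => i; rewrite row0.
set r := row i _.
have rH : r *m hess_yy g z = 0 by apply/sub_kermxP; exact: row_sub.
have H0 : hess_yy g z *m r^T = 0 by rewrite -[hess_yy g z]hess_yy_sym -trmx_mul rH trmx0.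
have := hess_pos z r^T; rewrite H0 [dotv _ 0]dotvE mulmx0 mxE pmulr_rle0// => h.
apply: trmx_inj; rewrite trmx0; apply: dotv_eq0.
by apply/eqP; rewrite eq_le h dotv_ge0.
Qed.

Lemma Hinv_enorm z v : enorm (Hinv g z *m v) <= mu^-1 * enorm v.
Proof.
set r := Hinv g z *m v.
have vE : v = hess_yy g z *m r by rewrite mulKVmx// hess_yy_unit.
have H1 := hess_pos z r; rewrite -vE in H1.
(* From [0 <= |v - mu *: r|^2]. Combined with [mu |r|^2 <= <r, v>] it gives
   [mu^2 |r|^2 <= |v|^2]. *)
have H2 : 2 * mu * dotv r v <= mu ^+ 2 * dotv r r + dotv v v.
  have := dotv_ge0 (v - mu *: r).
  rewrite dotvDl -scaleNr dotvZl !dotvDr !dotvZr (dotvC v r); nra.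
rewrite -[leRHS]ger0_norm ?mulr_ge0 ?invr_ge0 ?sqrtr_ge0 ?(ltW mu0)//.
rewrite -sqrtr_sqr ler_wsqrtr// exprMn enorm_sqr exprVn mulrC ler_pdivlMr ?exprn_gt0//.
have H3 : 2 * mu * (mu * dotv r r) <= 2 * mu * dotv r v.
  by rewrite ler_wpM2l// mulr_ge0// ltW.
nra.
Qed.

Lemma Hinv_norm z (v : 'cV[R]_p) : `|Hinv g z *m v| <= mu^-1 * p%:R * `|v|.
Proof.
rewrite (le_trans (norm_le_enorm _))// (le_trans (Hinv_enorm _ _))//.
by rewrite -mulrA ler_wpM2l ?invr_ge0 ?(ltW mu0)// enorm_le.
Qed.

End hessian.

(** * The Newton map *)

Lemma mulmx_norm_le (R : realType) (m k l : nat) (M : 'M[R]_(m, k)) (N : 'M[R]_(k, l)) :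
  `|M *m N| <= k%:R * (`|M| * `|N|).
Proof.
apply: mx_norm_le => [|i j]; first by rewrite !mulr_ge0.
rewrite mxE (le_trans (ler_norm_sum _ _ _))//.
rewrite mulr_natl -[X in _ *+ X](card_ord k) -sumr_const.
by apply: ler_sum => a _; rewrite normrM ler_pM ?norm_coord_le.
Qed.

Lemma mulmxr_continuous (R : realType) (m k l : nat) (N : 'M[R]_(k, l)) :
  continuous (fun M : 'M[R]_(m, k) => M *m N).
Proof.
apply: (@lipschitz_with_continuous _ _ _ (k%:R * `|N|)) => M M'.
by rewrite -mulmxBl (le_trans (mulmx_norm_le _ _))// -mulrA [`|N| * _]mulrC.
Qed.

Lemma subrACA (V : zmodType) (a b c d : V) : a - b - (c - d) = a - c - (b - d).
Proof. by rewrite !opprB [d - c]addrC addrACA [- b + d]addrC. Qed.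

(** A resolvent identity: the inverse at the first point acts on differences of the data, and the
    second inverse occurs only in the fixed vector [invmx A2 *m q2]. *)
Lemma invmx_mul_sub (R : realType) (p : nat) (A1 A2 : 'M[R]_p) (q1 q2 : 'cV[R]_p) :
  A1 \in unitmx -> A2 \in unitmx ->
  invmx A1 *m q1 - invmx A2 *m q2 =
    invmx A1 *m (q1 - q2 - (A1 - A2) *m (invmx A2 *m q2)).
Proof.
move=> u1 u2; rewrite mulmxBl (mulKVmx u2) opprB addrA subrK mulmxBr.
by rewrite (mulKmx u1).
Qed.

Lemma invmx_mulB (R : realType) (p : nat) (A : 'M[R]_p) (b v : 'cV[R]_p) :
  A \in unitmx -> invmx A *m (b - A *m v) = invmx A *m b - v.
Proof. by move=> uA; rewrite mulmxBr (mulKmx uA). Qed.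

(** Here [A] is the Hessian, [X] the mixed block, and [T1], [T2] are the third derivatives along the
    Newton step. The chain rule gives the left side; [JAx] and [JAy] are transposed Jacobians, hence
    the transposes and the use of symmetry. *)
Lemma newton_jacobianE (R : realType) (n p : nat) (A T2 : 'M[R]_p)
    (X T1 : 'M[R]_(n, p)) (v1 : 'cV[R]_n) (v2 : 'cV[R]_p) :
  A \in unitmx -> A^T = A ->
  v2 - invmx A *m (X^T *m v1 + A *m v2 - (T1^T *m v1 + T2^T *m v2)) =
  (- (X *m invmx A) + T1 *m invmx A)^T *m v1 + (T2 *m invmx A)^T *m v2.
Proof.
move=> uA sA.
have HT : (invmx A)^T = invmx A by rewrite trmx_inv sA.
have E : (- (X *m invmx A) + T1 *m invmx A)^T = - (invmx A *m X^T) + invmx A *m T1^T.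
  by rewrite linearD linearN /= !trmx_mul HT.
rewrite E trmx_mul HT mulmxDl mulNmx mulmxBr !mulmxDr (mulKmx uA).
rewrite -!mulmxA; set a := _ *m (X^T *m v1); set b := _ *m (T1^T *m v1).
set c := _ *m (T2^T *m v2).
by rewrite opprB addrC opprD addrA subrK addrC addrA.
Qed.

Section objective.
Context {R : realType} {n p : nat}.
Local Notation Z := ('cV[R]_n * 'cV[R]_p)%type.
Variables (f g : Z -> R) (Mf mu Lg Qg : R).
Hypothesis hA1 : assumption_A1 f g Mf mu Lg Qg.
Local Notation K := ((n + p)%:R : R).

Let Mf0 : 0 < Mf. Proof. by case: hA1 => -[]. Qed.
Let mu0 : 0 < mu. Proof. by case: hA1 => -[? []]. Qed.
Let Lg0 : 0 < Lg. Proof. by case: hA1 => -[? [? []]]. Qed.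
Let Qg0 : 0 < Qg. Proof. by case: hA1 => -[? [? [? ]]]. Qed.
Let f_lip z1 z2 : `|f z1 - f z2| <= Mf * pnorm (z1 - z2).
Proof. by case: hA1 => _ []. Qed.
Let dg z : differentiable g z.
Proof. by case: hA1 => _ [_ [/(_ z)[]]]. Qed.
Let dgrad z : differentiable (fun w => (grad_x g w, grad_y g w)) z.
Proof. by case: hA1 => _ [_ [/(_ z)[]]]. Qed.
Let hess_pos z (v : 'cV[R]_p) : mu * dotv v v <= dotv v (hess_yy g z *m v).
Proof. by case: hA1 => _ [_ [_ []]]. Qed.
Let grad_lip z1 z2 : pnorm ((grad_x g z1, grad_y g z1) - (grad_x g z2, grad_y g z2))
                    <= Lg * pnorm (z1 - z2).
Proof. by case: hA1 => _ [_ [_ [_ []]]]. Qed.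
Let hess_lip z1 z2 (v : 'cV[R]_p) :
  enorm ((hess_yy g z1 - hess_yy g z2) *m v) <= Qg * pnorm (z1 - z2) * enorm v.
Proof. by case: hA1 => _ [_ [_ [_ [_ []]]]]. Qed.
Let dhess z : differentiable (hess_yy g) z.
Proof. by case: hA1 => _ [_ [_ [_ [_ [_ [_ []]]]]]]. Qed.
Let chess v : continuous (fun z => derive (hess_yy g) z v).
Proof. by case: hA1 => _ [_ [_ [_ [_ [_ [_ []]]]]]]. Qed.
Let Hsym z : (hess_yy g z)^T = hess_yy g z.
Proof. exact: (hess_yy_sym dg dgrad dhess). Qed.
Let Hunit z : hess_yy g z \in unitmx.
Proof. exact: (hess_yy_unit mu0 dg dgrad hess_pos dhess). Qed.
Let Hinv_bounded : exists2 c, 0 < c &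
  forall z (v : 'cV[R]_p), `|Hinv g z *m v| <= c * `|v|.
Proof.
have i0 : 0 <= mu^-1 * p%:R by rewrite mulr_ge0// invr_ge0 ltW.
(* The added 1 keeps the constant positive when [p = 0]; it is a divisor later. *)
exists (mu^-1 * p%:R + 1); first by rewrite ltr_wpDl.
move=> z v; apply: (le_trans (Hinv_norm mu0 dg dgrad hess_pos dhess z v)).
by rewrite ler_wpM2r// lerDl.
Qed.

Lemma grad_y_lipschitz : lipschitz_with (Lg * K) (grad_y g).
Proof.
move=> z1 z2; have H := grad_lip z1 z2.
apply: (le_trans (norm_snd_le (_, grad_y g z1 - grad_y g z2))).
apply: (le_trans (norm_le_pnorm _)); apply: (le_trans H).
by rewrite -mulrA ler_wpM2l ?pnorm_le// ltW.
Qed.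

Lemma grad_y_bounded B : exists2 C, 0 <= C & forall z, `|z| <= B -> `|grad_y g z| <= C.
Proof.
exists (Lg * K * `|B| + `|grad_y g 0|).
  by rewrite addr_ge0// !mulr_ge0// ltW.
move=> z zB; rewrite -lerBlDr (le_trans (lerB_dist _ _))//.
rewrite (le_trans (grad_y_lipschitz _ _))// subr0 ler_wpM2l ?mulr_ge0 ?(ltW Lg0)//.
by rewrite (le_trans zB)// ler_norm.
Qed.

Let HK z (v : 'cV[R]_p) : hess_yy g z *m (Hinv g z *m v) = v.
Proof. exact: mulKVmx. Qed.
Let step z := Hinv g z *m grad_y g z.

Let step_sub z1 z2 : step z1 - step z2 =
  Hinv g z1 *m (grad_y g z1 - grad_y g z2 - (hess_yy g z1 - hess_yy g z2) *m step z2).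
Proof.
exact: invmx_mul_sub.
Qed.

(** In [step_sub] the change of the Hessian multiplies a Newton step, and the bound on that step
    comes from the bound on [grad_y] over a ball. Hence a constant depending on [B]. *)
Lemma Amap_lipschitz_on B : exists2 L, 0 <= L &
  forall z1 z2, `|z1| <= B -> `|z2| <= B -> `|Amap g z1 - Amap g z2| <= L * `|z1 - z2|.
Proof.
have [C C0 HC] := grad_y_bounded B.
have [c /ltW c0 Hc] := Hinv_bounded.
have [Lg1 Qg1] := (ltW Lg0, ltW Qg0).
exists (1 + c * (Lg * K + Qg * K * (p%:R * (c * C)))).
  by rewrite addr_ge0// mulr_ge0// addr_ge0 ?mulr_ge0.
move=> z1 z2 h1 h2.
have -> : Amap g z1 - Amap g z2 = (z1 - z2).2 - (step z1 - step z2).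
  exact: subrACA.
rewrite (le_trans (ler_normB _ _))// mulrDl mul1r lerD ?norm_snd_le//.
rewrite step_sub (le_trans (Hc _ _))// -mulrA ler_wpM2l//.
rewrite (le_trans (ler_normB _ _))// mulrDl lerD ?grad_y_lipschitz//.
rewrite (le_trans (norm_le_enorm _))// (le_trans (hess_lip _ _ _))//.
rewrite -!mulrA ler_wpM2l ?(ltW Qg0)//.
rewrite (_ : K * _ = K * `|z1 - z2| * (p%:R * (c * C))); last by ring.
apply: ler_pM; rewrite ?pnorm_ge0 ?sqrtr_ge0 ?pnorm_le//.
rewrite (le_trans (enorm_le _))// ler_wpM2l//.
by rewrite (le_trans (Hc _ _))// ler_wpM2l// HC.
Qed.

Lemma penalty_lipschitz_on B : exists2 L, 0 <= L &
  forall z1 z2, `|z1| <= B -> `|z2| <= B ->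
    `|enorm (grad_y g z1) ^+ 2 - enorm (grad_y g z2) ^+ 2| <= L * `|z1 - z2|.
Proof.
have [C C0 HC] := grad_y_bounded B.
exists (p%:R * (Lg * K * (C + C))).
  by rewrite !mulr_ge0 ?addr_ge0// ltW.
move=> z1 z2 h1 h2; rewrite !enorm_sqr.
set a := grad_y g z1; set b := grad_y g z2.
have -> : dotv a a - dotv b b = dotv (a - b) (a + b).
  rewrite dotvDl -[- b]scaleN1r dotvZl !dotvDr (dotvC b a); ring.
rewrite (le_trans (dotv_le _ _))// -[leRHS]mulrA ler_wpM2l//.
rewrite (_ : _ * `|z1 - z2| = Lg * K * `|z1 - z2| * (C + C)); last by ring.
rewrite ler_pM ?grad_y_lipschitz//.
by rewrite (le_trans (ler_normD _ _))// lerD// HC.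
Qed.

Lemma newton_pair_lipschitz_on B : exists2 L, 0 <= L &
  forall z1 z2, `|z1| <= B -> `|z2| <= B ->
    `|(z1.1, Amap g z1) - (z2.1, Amap g z2)| <= L * `|z1 - z2|.
Proof.
have [L L0 HL] := Amap_lipschitz_on B.
exists (L + 1); first by rewrite addr_ge0.
move=> z1 z2 h1 h2; apply: norm_pair_le => /=.
  rewrite (le_trans (norm_fst_le (z1 - z2)))// mulrDl mul1r lerDr mulr_ge0//.
by rewrite (le_trans (HL _ _ h1 h2))// ler_wpM2r// lerDl.
Qed.

Lemma hfun_lipschitz_on beta B : exists2 L, 0 <= L &
  forall z1 z2, `|z1| <= B -> `|z2| <= B ->
    `|hfun f g beta z1 - hfun f g beta z2| <= L * `|z1 - z2|.
Proof.
have [L1 L10 H1] := newton_pair_lipschitz_on B.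
have [L2 L20 H2] := penalty_lipschitz_on B.
exists (Mf * K * L1 + `|beta / 2| * L2).
  by rewrite addr_ge0 ?mulr_ge0// ltW.
move=> z1 z2 h1 h2; rewrite /hfun opprD addrACA -mulrBr.
rewrite (le_trans (ler_normD _ _))// mulrDl lerD//.
  rewrite (le_trans (f_lip _ _))// -!mulrA ler_wpM2l ?(ltW Mf0)//.
  by rewrite (le_trans (pnorm_le _))// ler_wpM2l// H1.
by rewrite normrM -mulrA ler_wpM2l// H2.
Qed.

(** By [step_sub] the difference quotient is [Hinv g (S h) *m b h] with [b h] tending to [b0]. Its
    distance to the claimed limit is [Hinv g (S h)] applied to [b h - hess_yy g (S h) *m (Hinv g (s
    t) *m b0)], which tends to 0, and [Hinv] is uniformly bounded. *)
Lemma is_derive_step (s : R -> Z) t ds : is_derive t (1 : R) s ds ->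
  is_derive t (1 : R) (step \o s)
    (Hinv g (s t) *m ('D_ds (grad_y g) (s t) - 'D_ds (hess_yy g) (s t) *m step (s t))).
Proof.
move=> dsd.
have [dq qE] := is_derive_comp_curve (differentiable_grad_y dgrad (s t)) dsd.
have [dP PE] := is_derive_comp_curve (dhess (s t)) dsd.
have cs : {for t, continuous s}.
  by apply: differentiable_continuous; apply/derivable1_diffP; have [] := dsd.
set b0 := _ - _.
suff H : h^-1 *: (((step \o s) \o shift t) (h *: (1 : R)) - step (s t)) @[h --> 0^'] -->
    Hinv g (s t) *m b0.
  by apply: DeriveDef; [apply/cvg_ex; eexists; exact: H|exact/cvg_lim].
pose S (h : R) := s (h *: 1 + t).
pose b (h : R) := h^-1 *: (grad_y g (S h) - grad_y g (s t)) -
  (h^-1 *: (hess_yy g (S h) - hess_yy g (s t))) *m step (s t).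
have cb : b h @[h --> 0^'] --> b0.
  apply: cvgB; first by rewrite -qE; exact: dq.
  apply: (@cvg_comp _ _ _ (fun h : R => h^-1 *: (hess_yy g (S h) - hess_yy g (s t)))
    (fun M : 'M[R]_p => M *m step (s t)) (0^') (nbhs ('D_ds (hess_yy g) (s t)))).
    by rewrite -PE; exact: dP.
  exact: mulmxr_continuous.
have cS : S h @[h --> 0^'] --> s t.
  apply: (@cvg_comp _ _ _ (fun h : R => h *: (1 : R) + t) s _ (nbhs t)); last exact: cs.
  apply: cvg_within_filter; under eq_fun do rewrite [_ *: 1]mulr1.
  have : h + t @[h --> (0 : R)] --> 0 + t by apply: cvgD; [exact: cvg_id|exact: cvg_cst].
  by rewrite add0r.
have cH : (hess_yy g (S h) *m (Hinv g (s t) *m b0)) @[h --> 0^'] --> b0.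
  rewrite -[X in _ --> X](HK (s t)).
  apply: (@cvg_comp _ _ _ (fun h : R => hess_yy g (S h))
    (fun M : 'M[R]_p => M *m (Hinv g (s t) *m b0)) (0^') (nbhs (hess_yy g (s t)))).
    by apply: cvg_comp cS _; exact: differentiable_continuous.
  exact: mulmxr_continuous.
apply/cvgrPdist_le => e e0.
have [c c0 Hc] := Hinv_bounded.
have cB : b h - hess_yy g (S h) *m (Hinv g (s t) *m b0) @[h --> 0^'] --> b0 - b0.
  exact: cvgB.
move: cB; rewrite [b0 - b0]subrr => /cvgrPdist_le/(_ (e / c) (divr_gt0 e0 c0)).
apply: filterS => h /=; rewrite sub0r normrN => Hh.
rewrite /= -/(S h) step_sub scalemxAr.
have -> : h^-1 *: (grad_y g (S h) - grad_y g (s t) -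
     (hess_yy g (S h) - hess_yy g (s t)) *m step (s t)) = b h.
  by rewrite scalerBr scalemxAl.
rewrite distrC.
have -> : Hinv g (S h) *m b h - Hinv g (s t) *m b0 =
    Hinv g (S h) *m (b h - hess_yy g (S h) *m (Hinv g (s t) *m b0)).
  exact: (esym (invmx_mulB _ _ (Hunit (S h)))).
by apply: (le_trans (Hc _ _)); rewrite mulrC -ler_pdivlMr.
Qed.

Lemma is_derive_Amap (s : R -> Z) t ds : is_derive t (1 : R) s ds ->
  is_derive t (1 : R) (Amap g \o s)
    ((JAx g (s t))^T *m ds.1 + (JAy g (s t))^T *m ds.2).
Proof.
move=> dsd.
have H1 : is_derive t (1 : R) (snd \o s) ds.2.
  have := is_derive_comp_curve (differentiable_snd (s t)) dsd.
  rewrite deriveE; last exact: differentiable_snd.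
  by rewrite diff_lin// => x; exact: cvg_snd.
have := is_deriveB H1 (is_derive_step dsd).
rewrite (_ : (snd \o s) - (step \o s) = Amap g \o s)//.
congr is_derive.
rewrite (derive_grad_y dgrad) (derive_hess_yy_mul dg dgrad dhess chess) Hsym.
exact: (newton_jacobianE _ _ _ _ _ (Hunit (s t)) (Hsym (s t))).
Qed.

End objective.

(** * Inner products and Lipschitz curves in the product space *)

Lemma is_derive_coord (R : realType) (m k : nat) (a : R -> 'M[R]_(m, k)) t da i j :
  is_derive t (1 : R) a da -> is_derive t (1 : R) (fun s => a s i j) (da i j).
Proof.
move=> [ha <-]; apply: DeriveDef; first by move/derivable_mxP : ha.
by rewrite derive_mx// mxE.
Qed.

Lemma is_derive_dotv (R : realType) (m : nat) (a b : R -> 'cV[R]_m) t da db :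
  is_derive t (1 : R) a da -> is_derive t (1 : R) b db ->
  is_derive t (1 : R) (fun s => dotv (a s) (b s)) (dotv da (b t) + dotv (a t) db).
Proof.
move=> ha hb.
have H i : is_derive t (1 : R) ((fun s => a s i 0) * (fun s => b s i 0))
    (a t i 0 *: db i 0 + b t i 0 *: da i 0).
  by apply: is_deriveM; exact: is_derive_coord.
have := is_derive_sum H.
rewrite (_ : \sum_(i < m) _ = (fun s => dotv (a s) (b s))); last first.
  by apply/funext => s; rewrite fct_sumE.
congr is_derive; rewrite big_split/= addrC; congr (_ + _).
by apply: eq_bigr => i _; rewrite mulrC.
Qed.

Section pair_curves.
Context {R : realType} {n p : nat}.
Local Notation Z := ('cV[R]_n * 'cV[R]_p)%type.

Lemma is_derive_fst (s : R -> Z) t ds :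
  is_derive t (1 : R) s ds -> is_derive t (1 : R) (fun u => (s u).1) ds.1.
Proof.
move=> dsd; have := is_derive_comp_curve (differentiable_fst (s t)) dsd.
rewrite deriveE; last exact: differentiable_fst.
by rewrite diff_lin// => x; exact: cvg_fst.
Qed.

Lemma is_derive_snd (s : R -> Z) t ds :
  is_derive t (1 : R) s ds -> is_derive t (1 : R) (fun u => (s u).2) ds.2.
Proof.
move=> dsd; have := is_derive_comp_curve (differentiable_snd (s t)) dsd.
rewrite deriveE; last exact: differentiable_snd.
by rewrite diff_lin// => x; exact: cvg_snd.
Qed.

Lemma is_derive_pdot (a : Z) (s : R -> Z) t ds :
  is_derive t (1 : R) s ds -> is_derive t (1 : R) (fun u => pdot a (s u)) (pdot a ds).
Proof.
move=> dsd.
have H1 := is_derive_dotv (is_derive_cst a.1 t 1) (is_derive_fst dsd).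
have H2 := is_derive_dotv (is_derive_cst a.2 t 1) (is_derive_snd dsd).
have := is_deriveD H1 H2; congr is_derive; rewrite /pdot /=.
have d0 m (v : 'cV[R]_m) : dotv 0 v = 0 by rewrite dotvE trmx0 mul0mx mxE.
by rewrite !d0 !add0r.
Qed.

Lemma lipschitz_ae_derivable (s : R -> Z) (L : R) : lipschitz_with L s ->
  {ae (@lebesgue_measure R), forall t : R, 0 < t < 1 -> derivable s t (1 : R)}.
Proof.
move=> sL.
have H1 : {ae (@lebesgue_measure R), forall t : R, forall i : 'I_n, 0 < t < 1 ->
    derivable (fun u => (s u).1 i 0) t (1 : R)}.
  apply: (@filter_forall _ _ _ _ (ae_filter_ringOfSetsType _)) => i.
  have [|rho [_ H _]] := @lipschitz_ftc R (fun u => (s u).1 i 0) L.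
    move=> u v; apply: le_trans (sL u v); apply: le_trans (norm_fst_le _).
    by have := norm_coord_le (s u - s v).1 i 0; rewrite !mxE.
  by apply: (@filterS _ _ (ae_filter_ringOfSetsType _) _ _ _ H) => t Ht /Ht [].
have H2 : {ae (@lebesgue_measure R), forall t : R, forall i : 'I_p, 0 < t < 1 ->
    derivable (fun u => (s u).2 i 0) t (1 : R)}.
  apply: (@filter_forall _ _ _ _ (ae_filter_ringOfSetsType _)) => i.
  have [|rho [_ H _]] := @lipschitz_ftc R (fun u => (s u).2 i 0) L.
    move=> u v; apply: le_trans (sL u v); apply: le_trans (norm_snd_le _).
    by have := norm_coord_le (s u - s v).2 i 0; rewrite !mxE.
  by apply: (@filterS _ _ (ae_filter_ringOfSetsType _) _ _ _ H) => t Ht /Ht [].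
apply: (@filterS2 _ _ (ae_filter_ringOfSetsType _) _ _ _ _ H1 H2) => t h1 h2 t01.
have d1 : derivable (fun u => (s u).1) t (1 : R).
  by apply/derivable_mxP => i j; rewrite (ord1 j); exact: h1.
have d2 : derivable (fun u => (s u).2) t (1 : R).
  by apply/derivable_mxP => i j; rewrite (ord1 j); exact: h2.
have [+ _] := is_derive_pair (derivableP d1) (derivableP d2).
by rewrite (_ : (fun u => _) = s)//; apply/funext => u; case: (s u).
Qed.

Lemma lipschitz_abs_cont (s : R -> Z) (L : R) : lipschitz_with L s -> abs_cont_curve s.
Proof.
move=> sL e e0.
pose c := (n + p)%:R * `|L| + 1 : R.
have c0 : 0 < c by rewrite ltr_wpDl// mulr_ge0.
exists (e / c); first by rewrite divr_gt0.
move=> k a b ab _ sumlt.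
apply: (@le_lt_trans _ _ (\sum_i c * (b i - a i))).
  apply: ler_sum => i _; have [_ [aibi _]] := ab i.
  rewrite (le_trans (pnorm_le _))//.
  apply: (@le_trans _ _ ((n + p)%:R * (`|L| * (b i - a i)))).
    rewrite ler_wpM2l// (le_trans (sL _ _))//.
    by rewrite (ger0_norm (_ : 0 <= b i - a i)) ?subr_ge0// ler_wpM2r ?subr_ge0// ler_norm.
  by rewrite mulrA ler_wpM2r ?subr_ge0// lerDl.
by rewrite -mulr_sumr mulrC -ltr_pdivlMr.
Qed.

(* Where [s] is not derivable, [derive1 s t] is the arbitrary value [point]. *)
Lemma lipschitz_derive1_bounded (s : R -> Z) (L : R) : lipschitz_with L s ->
  forall t, `|derive1 s t| <= Num.max `|L| `|point : Z|.
Proof.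
move=> sL t; rewrite /derive1.
have [/cvg_ex[l hl]|ncvg] := pselect (cvg (h^-1 *: (s (h + t) - s t) @[h --> 0^'])).
  rewrite (cvg_lim _ hl)// le_max; apply/orP; left.
  apply: (cvgr_to_le (cvg_norm hl)); near=> h.
  have h0 : h != 0 by near: h; exact: nbhs_dnbhs_neq.
  rewrite normrZ normfV mulrC ler_pdivrMr ?normr_gt0//.
  by rewrite (le_trans (sL _ _))// addrK ler_wpM2r// ler_norm.
by rewrite dvgP// le_max lexx orbT.
Unshelve. all: by end_near. Qed.

End pair_curves.

(** * Descent along curves *)

(** The chain rule in dual form: when the point moves with velocity [v], the first argument on the
    right is the velocity of the pair formed by [x] and [Amap], and the last term is the derivative
    of the penalty. *)
Lemma pdot_Dh_element (R : realType) (n p : nat) (d v : 'cV[R]_n * 'cV[R]_p)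
    (J1 X : 'M[R]_(n, p)) (J2 A : 'M[R]_p) (q : 'cV[R]_p) (beta : R) :
  pdot (d.1 + J1 *m d.2 + beta *: (X *m q), J2 *m d.2 + beta *: (A *m q)) v =
  pdot (v.1, J1^T *m v.1 + J2^T *m v.2) d + beta * dotv q (X^T *m v.1 + A^T *m v.2).
Proof.
rewrite /pdot /= (dotvC _ d.2) (dotvC v.1) !dotvDl !dotvDr !dotvZl.
rewrite (dotv_mulmx J1) (dotv_mulmx J2) (dotv_mulmx X) (dotv_mulmx A); ring.
Qed.

Section descent.
Context {R : realType} {n p : nat}.
Local Notation Z := ('cV[R]_n * 'cV[R]_p)%type.
Variables (f g : Z -> R) (Df D : Z -> set Z) (Mf mu Lg Qg beta delta : R).
Hypothesis hA1 : assumption_A1 f g Mf mu Lg Qg.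
Hypothesis hA2 : assumption_A2 f Df Mf.
Hypothesis hdelta : 0 < delta.
Hypothesis hf : forall z w, D z w ->
  ((delta * pnorm w ^+ 2)%:E <= ereal_sup [set (pdot zeta w)%:E | zeta in Dh Df g beta z])%E.

(** Supplies the constant [K] of [integral_ge_lipschitz], also at times where the curve has no
    derivative. *)
Lemma field_integrand_bounded (s : R -> Z) (L : R) : lipschitz_with L s ->
  exists K, forall t, (K%:E <= field_integrand Df s t)%E.
Proof.
move=> sL; have [[_ Dne _] _ _ DM] := hA2.
exists (- ((n + p)%:R * (Num.max `|L| `|point : Z| * Mf))) => t.
have [[v Dv] _] := Dne (s t).
apply: (@le_trans _ _ (pdot (derive1 s t) v)%:E); last by apply: ereal_sup_ubound; exists v.
rewrite lee_fin lerNl (le_trans _ (le_trans (pdot_le (derive1 s t) v) _))//.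
  by rewrite -normrN ler_norm.
rewrite ler_wpM2l// ler_pM ?(lipschitz_derive1_bounded sL)//.
by apply: (le_trans (norm_le_pnorm _)); exact: DM Dv.
Qed.

(** Condition (f) at [w], transported from [Dh] to [Df] by [pdot_Dh_element] and linearized at [a].
    [T] is the duration of the original curve, whose parameter is rescaled to the unit interval. *)
Lemma field_integrand_ge (s : R -> Z) (T t : R) (w a : Z) : 0 < T ->
  is_derive t (1 : R) s (T *: w) -> D (s t) w ->
  ((delta * (2 * pdot a (T *: w) - T * pdot a a) -
     beta * dotv (grad_y g (s t)) ('D_(T *: w) (grad_y g) (s t)))%:E <=
   field_integrand Df (fun u => ((s u).1, Amap g (s u))) t)%E.
Proof.
move=> T0 dsd Dw.
have [_ [_ [/all_and2[_ dgrad] _]]] := hA1.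
have dG := is_derive_pair (is_derive_fst dsd) (is_derive_Amap hA1 dsd).
set q := beta * _; set ds := T *: w in dsd dG q *.
set z := s t in Dw q dG *.
pose Gd : Z := (ds.1, (JAx g z)^T *m ds.1 + (JAy g z)^T *m ds.2).
have dE : derive1 (fun u => ((s u).1, Amap g (s u))) t = Gd.
  by rewrite derive1E; case: dG.
rewrite /field_integrand dE -/z.
set S := ereal_sup _.
have ubS d : Df (z.1, Amap g z) d -> ((pdot Gd d)%:E <= S)%E.
  by move=> Dd; apply: ereal_sup_ubound; exists d.
have key : ((delta * T * pdot w w - q)%:E <= S)%E.
  have := hf Dw; rewrite pnorm_sqr.
  have -> : ereal_sup [set (pdot zeta w)%:E | zeta in Dh Df g beta z] =
      ereal_sup [set (T^-1 * (pdot Gd d + q))%:E | d in Df (z.1, Amap g z)].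
    congr ereal_sup; rewrite /Dh image_comp; apply: eq_imagel => d _ /=.
    congr (_%:E); apply: (mulfI (lt0r_neq0 T0)).
    rewrite mulVKf ?lt0r_neq0// -pdotZr -/ds pdot_Dh_element.
    by rewrite /q (derive_grad_y dgrad).
  (* A supremum equal to plus infinity leaves nothing to prove; minus infinity is excluded by an
     element of [Df]. *)
  case: S ubS => [S| |] ubS; last first.
  - move=> _; have [[_ Dne _] _ _ _] := hA2.
    by have [[v /ubS]] := Dne (z.1, Amap g z).
  - by rewrite leey.
  - move=> /le_trans H; have : ((delta * pdot w w)%:E <= (T^-1 * (S + q))%:E)%E.
      apply: H; apply: ge_ereal_sup => _ [d Dd <-].
      rewrite lee_fin ler_wpM2l ?invr_ge0 ?(ltW T0)// lerD2r.
      by have := ubS _ Dd; rewrite lee_fin.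
    rewrite !lee_fin [T^-1 * _]mulrC ler_pdivlMr// lerBlDr; apply: le_trans.
    by rewrite le_eqVlt; apply/orP; left; apply/eqP; ring.
apply: le_trans key; rewrite lee_fin lerD2r /ds pdotZr.
have := pdot_young w a; have dT : 0 < delta * T by rewrite mulr_gt0.
move=> /(ler_wpM2l (ltW dT)); apply: le_trans.
by rewrite le_eqVlt; apply/orP; left; apply/eqP; ring.
Qed.

Lemma curve_descent (s : R -> Z) (L B T : R) (a : Z) : 0 < T ->
  lipschitz_with L s -> (forall t, `|s t| <= B) ->
  (forall (t : R) ds, 0 < t < 1 -> is_derive t (1 : R) s ds ->
     exists2 w, D (s t) w & ds = T *: w) ->
  delta * (2 * pdot a (s 1 - s 0) - T * pdot a a) <=
    hfun f g beta (s 1) - hfun f g beta (s 0).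
Proof.
have aux (X Q1 Q0 F1 F0 : R) : X - Q1 + Q0 <= F1 - F0 -> X <= F1 + Q1 - (F0 + Q0) by lra.
move=> T0 sL sB incl.
have [_ [_ [/all_and2[_ dgrad] _]]] := hA1.
have [_ pot _ _] := hA2.
pose Gam u := ((s u).1, Amap g (s u)).
have L0 : 0 <= L by have := sL 1 0; rewrite subr0 normr1 mulr1; exact: le_trans.
have [L1 L10 H1] := newton_pair_lipschitz_on hA1 B.
have GamL : lipschitz_with (L1 * L) Gam.
  by move=> u v; rewrite (le_trans (H1 _ _ _ _))// -mulrA ler_wpM2l.
have [L2 L20 H2] := penalty_lipschitz_on hA1 B.
pose q t := enorm (grad_y g (s t)) ^+ 2.
have qL u v : `|q u - q v| <= L2 * L * `|u - v|.
  by rewrite (le_trans (H2 _ _ _ _))// -mulrA ler_wpM2l.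
pose c := delta * (T * pdot a a).
(* An antiderivative of the lower bound in [field_integrand_ge]: its increment bounds the field
   integral, that is the increment of [f] along [Gam]. Moving the penalty to the other side gives
   the increment of [hfun]. *)
pose G (t : R) := 2 * delta * pdot a (s t) - beta / 2 * q t - c * t.
have GL : lipschitz_with (`|2 * delta| * ((n + p)%:R * (`|a| * L)) +
    `|beta / 2| * (L2 * L) + `|c|) G.
  move=> u v; rewrite /G.
  have -> : 2 * delta * pdot a (s u) - beta / 2 * q u - c * u -
    (2 * delta * pdot a (s v) - beta / 2 * q v - c * v) =
    2 * delta * (pdot a (s u) - pdot a (s v)) - beta / 2 * (q u - q v) - c * (u - v).
    by move: (pdot a _) (pdot a _) (q _) (q _) => X1 X2 Y1 Y2; ring.
  rewrite (le_trans (ler_normB _ _))// normrM [in leRHS]mulrDl lerD//.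
  rewrite (le_trans (ler_normB _ _))// normrM [`|_ / 2 * _|]normrM [in leRHS]mulrDl lerD//.
    rewrite -pdotBr -!mulrA ler_wpM2l// (le_trans (pdot_le _ _))// ler_wpM2l// ler_wpM2l//.
  by rewrite -[in leRHS]mulrA ler_wpM2l.
have [K HK] := field_integrand_bounded GamL.
have := integral_ge_lipschitz GL HK; rewrite -/(field_integral Df Gam).
rewrite -(pot _ (lipschitz_abs_cont GamL)) lee_fin.
have -> : G 1 - G 0 = delta * (2 * pdot a (s 1 - s 0) - T * pdot a a) -
    beta / 2 * q 1 + beta / 2 * q 0.
  rewrite /G /c pdotBr.
  by move: (pdot a _) (pdot a _) (pdot a _) (q _) (q _) => X1 X2 X3 Y1 Y2; ring.
rewrite /hfun -/(Gam 1) -/(Gam 0) -/(q 1) -/(q 0) => H.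
apply: aux; apply: H.
apply: (@filterS _ _ (ae_filter_ringOfSetsType _) _ _ _ (lipschitz_ae_derivable sL)).
move=> t Ht t01 _.
have dsd := derivableP (Ht t01).
have [w Dw dsE] := incl _ _ t01 dsd; rewrite dsE in dsd.
have := field_integrand_ge a T0 dsd Dw; apply: le_trans; rewrite lee_fin.
have dq := is_derive_comp_curve (differentiable_grad_y dgrad (s t)) dsd.
have dq2 := is_derive_dotv dq dq.
have dG := is_deriveB (is_deriveB (is_deriveZ (2 * delta) (is_derive_pdot a dsd))
   (is_deriveZ (beta / 2) dq2)) (is_deriveZ c (is_derive_id t 1)).
have -> : G = (2 * delta) \*: (fun u => pdot a (s u)) -
   (beta / 2) \*: (fun u => dotv (grad_y g (s u)) (grad_y g (s u))) - c \*: id.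
  by apply/funext => u; rewrite /G /q enorm_sqr.
rewrite (@derive_val _ _ _ _ _ _ _ dG) /=.
rewrite le_eqVlt; apply/orP; left; apply/eqP.
rewrite [dotv ('D_(T *: w) _ _) _]dotvC /c.
move: (dotv _ _) (pdot a (T *: w)) (pdot a a) => X Y V.
by rewrite /GRing.scale /=; field.
Qed.

End descent.

(** * Ultralimits *)

(** The ultrafilter records properties that hold together at arbitrarily large indices; bounded
    sequences then converge along it without further extraction. *)
Lemma ultra_of_base (B : nat -> set nat) :
  (forall i, B i !=set0) -> (forall i j, (i <= j)%N -> B j `<=` B i) ->
  exists U : set_system nat, UltraFilter U /\ forall i, U (B i).
Proof.
move=> Bne Bdec.
have FF : ProperFilter (filter_from [set: nat] B).
  apply: filter_from_proper => //; apply: filter_from_filter; first by exists 0%N.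
  move=> i j _ _; exists (maxn i j) => // k Bk; split.
    by apply: Bdec Bk; rewrite leq_maxl.
  by apply: Bdec Bk; rewrite leq_maxr.
have [U [UU FU]] := ultraFilterLemma FF.
by exists U; split => // i; apply: FU; exists i.
Qed.

Lemma infty_sub_filter (U : set_system nat) : Filter U ->
  (forall i, U [set j | (i <= j)%N]) -> \oo `<=` U.
Proof. by move=> FU H A [N _ NA]; apply: filterS (H N) => j; exact: NA. Qed.

Lemma cvg_sub_filter (T : topologicalType) (U : set_system nat) (a : nat -> T) (l : T) :
  \oo `<=` U -> a @ \oo --> l -> a @ U --> l.
Proof. by move=> oU al A /al; exact: oU. Qed.

Section ultralimit.
Context {R : realType}.

Lemma real_ultralimit (U : set_system nat) (a : nat -> R) (B : R) :
  UltraFilter U -> (forall k, `|a k| <= B) -> exists l : R, a @ U --> l.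
Proof.
move=> UU aB.
have [l [_ cl]] : `[- B, B] `&` cluster (a @ U) !=set0.
  apply: segment_compact.
  apply: (@filterS _ U _ setT); last exact: filterT.
  by move=> k _ /=; rewrite in_itv/= -ler_norml aB.
exists l => A nA; rewrite /= /nbhs/=.
have [//|UnA] := in_ultra_setVsetC (a @^-1` A) UU.
have [x [nAx Ax]] := cl (~` A) A UnA nA.
by [].
Qed.

Lemma col_ultralimit (m : nat) (U : set_system nat) (a : nat -> 'cV[R]_m) (B : R) :
  UltraFilter U -> (forall k, `|a k| <= B) -> exists l : 'cV[R]_m, a @ U --> l.
Proof.
move=> UU aB.
have /choice[l Hl] : forall i, exists l : R, (fun k => a k i 0) @ U --> l.
  move=> i; apply: (@real_ultralimit _ _ B) => k.
  by rewrite (le_trans (norm_coord_le _ _ _)).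
exists (\col_i l i); apply/cvgrPdist_le => e e0.
have : \forall k \near U, forall i, `|l i - a k i 0| <= e.
  by apply: filter_forall => i; have /cvgrPdist_le/(_ _ e0) := Hl i.
apply: filterS => k Hk; apply: mx_norm_le; first exact: ltW.
by move=> i j; rewrite (ord1 j) !mxE.
Qed.

Context {n p : nat}.
Local Notation Z := ('cV[R]_n * 'cV[R]_p)%type.

Lemma pair_ultralimit (U : set_system nat) (a : nat -> Z) (B : R) :
  UltraFilter U -> (forall k, `|a k| <= B) -> exists l : Z, a @ U --> l.
Proof.
move=> UU aB.
have [l1 H1] := @col_ultralimit n U (fun k => (a k).1) B UU
  (fun k => le_trans (norm_fst_le _) (aB k)).
have [l2 H2] := @col_ultralimit p U (fun k => (a k).2) B UU
  (fun k => le_trans (norm_snd_le _) (aB k)).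
exists (l1, l2).
rewrite (_ : a = fun k => ((a k).1, (a k).2)).
  exact: (@cvg_pair _ _ _ U (nbhs l1) (nbhs l2) _ _ _ _ _ H1 H2).
by apply/funext => k; case: (a k).
Qed.

Lemma dist_set_cvg0 (a : nat -> Z) (S : set Z) :
  (fun N => dist_set (a N) S) @ \oo --> (0%R)%:E ->
  forall e, 0 < e -> \forall N \near \oo, exists2 d, S d & `|a N - d| < e.
Proof.
move=> H e e0.
have : \forall N \near \oo, (dist_set (a N) S < e%:E)%E.
  have nO : nbhs (0%R : R)%:E [set y | (y < e%:E)%E].
    by apply: open_nbhs_nbhs; split; [exact: open_ereal_lt_ereal|rewrite /= lte_fin].
  exact: (H _ nO).
apply: filterS => N /ereal_inf_lt[_ [d Sd <-]]; rewrite lte_fin => H1.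
by exists d => //; apply: le_lt_trans H1; exact: norm_le_pnorm.
Qed.

Lemma compact_norm_bounded (S : set Z) : compact S -> exists M, forall d, S d -> `|d| <= M.
Proof.
move=> /compact_bounded[M [_ HM]]; exists (M + 1) => d Sd.
by apply: HM => //; rewrite ltrDl.
Qed.

Lemma compact_approx (S : set Z) (v : Z) : compact S ->
  (forall e, 0 < e -> exists2 d, S d & `|v - d| <= e) -> S v.
Proof.
move=> cS H.
have clS : closed S by apply: compact_closed => //; exact: norm_hausdorff.
apply: clS => A /nbhs_ballP[e /= e0 eA].
have e2 : 0 < e / 2 by rewrite divr_gt0.
have [d Sd vd] := H _ e2; exists d; split => //; apply: eA.
by rewrite -ball_normE /ball_/= (le_lt_trans vd)// ltr_pdivrMr// ltr_pMr// ltr1n.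
Qed.

End ultralimit.

Lemma extract_subsequence (P : nat -> nat -> Prop) :
  (forall i K, exists2 j, (K <= j)%N & P i j) ->
  exists kj : nat -> nat, {homo kj : a b / (a < b)%N} /\ forall i, P i (kj i).
Proof.
move=> H.
have /choice[c Hc] : forall iK : nat * nat, exists j, (iK.2 <= j)%N /\ P iK.1 j.
  by move=> [i K]; have [j] := H i K; exists j.
pose fix kj i := if i is i'.+1 then c (i, (kj i').+1) else c (0%N, 0%N).
exists kj; split.
  by apply: homo_ltn => [? ? ?|i]; [exact: ltn_trans|case: (Hc (i.+1, (kj i).+1))].
by case=> [|i]; [case: (Hc (0, 0))%N|case: (Hc (i.+1, (kj i).+1))].
Qed.

(** * The averaging condition *)

Section averaged_directions.
Context {R : realType} {n p : nat}.
Local Notation Z := ('cV[R]_n * 'cV[R]_p)%type.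
Variables (z u : nat -> Z) (D : Z -> set Z) (B : R).
Hypothesis zB : forall k, `|z k| <= B.
Hypothesis Dcompact : forall w, compact (D w).
Hypothesis havg : forall (kj : nat -> nat) (zt : Z),
  {homo kj : a b / (a < b)%N} -> (fun j => z (kj j)) @ \oo --> zt ->
  (fun N => dist_set ((N.+1%:R)^-1 *: \sum_(j < N.+1) u (kj j)) (D zt))
    @ \oo --> (0%R)%:E.

Lemma cvg_of_invS (kj : nat -> nat) (zt : Z) :
  (forall i, `|z (kj i) - zt| < i.+1%:R^-1) -> (fun j => z (kj j)) @ \oo --> zt.
Proof.
move=> H; apply/cvgrPdist_lt => e e0; near=> j.
rewrite distrC (lt_trans (H j))//; near: j; exact: (near_infty_natSinv_lt (PosNum e0)).
Unshelve. all: by end_near. Qed.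

Lemma partial_sums_bounded (kj : nat -> nat) (zt : Z) :
  {homo kj : a b / (a < b)%N} -> (fun j => z (kj j)) @ \oo --> zt ->
  exists M, \forall N \near \oo, `|\sum_(j < N.+1) u (kj j)| <= N.+1%:R * M.
Proof.
move=> kjinc kjz; have [M HM] := compact_norm_bounded (@Dcompact zt).
exists (M + 1); have := dist_set_cvg0 (havg kjinc kjz) ltr01.
apply: filterS => N [d Dd Hd].
rewrite mulrC -ler_pdivrMr// mulrC -[X in X * _]ger0_norm ?invr_ge0// -normrZ.
rewrite addrC -lerBlDr; apply: le_trans (ltW Hd); apply: le_trans (lerB_dist _ _).
by rewrite lerB// HM.
Qed.

(** One direction is the difference of two consecutive partial sums along a subsequence, and by (d)
    these grow at most linearly. Directions growing quadratically along a subsequence with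
    convergent [z] are therefore impossible. *)
Lemma directions_bounded : exists C, forall k, `|u k| <= C.
Proof.
apply: contrapT => nb.
have ub C : exists k, C < `|u k|.
  apply: contrapT => H; apply: nb; exists C => k.
  by rewrite leNgt; apply/negP => Hk; apply: H; exists k.
have ub2 (K : nat) C : exists2 k, (K <= k)%N & C < `|u k|.
  have [k Hk] := ub (`|C| + \sum_(i < K) `|u i|).
  have [kK|kK] := ltnP k K.
    move: Hk; rewrite (bigD1 (Ordinal kK))//= addrCA gtrDl ltNge addr_ge0//.
    exact: sumr_ge0.
  exists k => //; apply: le_lt_trans Hk.
  by rewrite (le_trans (ler_norm _))// lerDl sumr_ge0.
have [||U [UU HU]] := @ultra_of_base (fun i => [set j | (i <= j)%N /\ i%:R < `|u j|]).
- by move=> i; have [k] := ub2 i i%:R; exists k.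
- move=> i j ij k [jk Hk]; split; first exact: leq_trans jk.
  by apply: le_lt_trans Hk; rewrite ler_nat.
have [zt zU] := @pair_ultralimit _ _ _ U z B UU zB.
(* The factor [2 * i + 1] counts the terms of the two partial sums that isolate term [i]; the factor
   [i] eventually exceeds any constant [M]. *)
have [i K|kj [kjinc Hkj]] := @extract_subsequence (fun i j =>
    `|z j - zt| < i.+1%:R^-1 /\ ((2 * i + 1) * i)%:R < `|u j|).
  have H1 : \forall j \near U, `|z j - zt| < i.+1%:R^-1.
    have i0 : 0 < i.+1%:R^-1 :> R by rewrite invr_gt0.
    by have /cvgrPdist_lt/(_ _ i0) := zU; apply: filterS => j; rewrite distrC.
  have H2 := HU (maxn K ((2 * i + 1) * i)).
  have [j [Hj [Hj1 Hj2]]] := filter_ex (filterI H1 H2).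
  exists j; first by apply: leq_trans Hj1; exact: leq_maxl.
  by split=> //; apply: le_lt_trans Hj2; rewrite ler_nat leq_maxr.
have [M HM] := partial_sums_bounded kjinc (cvg_of_invS (fun i => (Hkj i).1)).
have [N0 _ HN0] := HM.
pose N := maxn N0 (Num.bound `|M|).
have NM : M < N.+1%:R.
  apply: (lt_le_trans (le_lt_trans (ler_norm _) (archi_boundP (normr_ge0 M)))).
  by rewrite ler_nat leqW// leq_maxr.
have A1 := HN0 N (leq_maxl _ _).
have A2 := HN0 N.+1 (leqW (leq_maxl _ _)).
have [_ uN] := Hkj N.+1.
have : `|u (kj N.+1)| <= N.+2%:R * M + N.+1%:R * M.
  apply: le_trans (lerD A2 A1); rewrite big_ord_recr/=.
  set S := \sum_(j < N.+1) _; set v := u _.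
  by rewrite -[v in `|v| <= _](addrK S) [v + S]addrC ler_normB.
rewrite leNgt => /negP; apply; apply: le_lt_trans uN.
rewrite -mulrDl -natrD natrM.
rewrite (_ : (2 * N.+1 + 1 = N.+2 + N.+1)%N); last by lia.
by rewrite ler_wpM2l// ltW.
Qed.

(** Otherwise some directions stay far from [D zt] while [z] tends to [zt]. Being bounded, they can
    be chosen all close to one vector [us]; their averages are then close to [us], and by (d) also
    close to [D zt]. *)
Lemma directions_near_field : forall zt e, 0 < e -> exists rho, exists K : nat,
  0 < rho /\ forall j, (K <= j)%N -> `|z j - zt| < rho ->
    exists2 d, D zt d & `|u j - d| <= e.
Proof.
move=> zt e e0; apply: contrapT => nH.
pose far j := ~ exists2 d, D zt d & `|u j - d| <= e.
have [||U [UU HU]] := @ultra_of_base (fun i => [set j | [/\ (i <= j)%N,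
   `|z j - zt| < i.+1%:R^-1 & far j]]).
- move=> i; apply: contrapT => H; apply: nH; exists (i.+1%:R^-1), i.
  split; first by rewrite invr_gt0.
  by move=> j ij zj; apply: contrapT => fj; apply: H; exists j.
- move=> i j ij k [jk Hk fk]; split => //; first exact: leq_trans jk.
  by apply: (lt_le_trans Hk); rewrite lef_pV2 ?posrE// ler_nat.
have [C HC] := directions_bounded.
have [us uU] := @pair_ultralimit _ _ _ U u C UU HC.
have e4 : 0 < e / 4 by rewrite divr_gt0.
have [i K|kj [kjinc Hkj]] := @extract_subsequence (fun i j =>
    [/\ `|z j - zt| < i.+1%:R^-1, far j & `|us - u j| <= e / 4]).
  have H1 : \forall j \near U, `|us - u j| <= e / 4.
    by have /cvgrPdist_le/(_ _ e4) := uU.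
  have [j [Hj [Hj1 Hj2 Hj3]]] := filter_ex (filterI H1 (HU (maxn K i))).
  exists j; first by apply: leq_trans Hj1; exact: leq_maxl.
  split=> //; apply: (lt_le_trans Hj2).
  by rewrite lef_pV2 ?posrE// ler_nat ltnS leq_maxr.
have kjz : (fun j => z (kj j)) @ \oo --> zt.
  by apply: cvg_of_invS => i; case: (Hkj i).
have [N [d Dd Hd]] := filter_ex (dist_set_cvg0 (havg kjinc kjz) e4).
have [_ fN HN] := Hkj 0%N; apply: fN; exists d => //.
set a := _ *: _ in Hd.
have Ha : `|us - a| <= e / 4.
  have -> : us - a = N.+1%:R^-1 *: \sum_(j < N.+1) (us - u (kj j)).
    by rewrite sumrB sumr_const card_ord scalerBr -[us *+ _]scaler_nat scalerA mulVf ?scale1r//.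
  rewrite normrZ ger0_norm ?invr_ge0// mulrC ler_pdivrMr//.
  rewrite (le_trans (ler_norm_sum _ _ _))//.
  rewrite mulrC mulr_natl -[X in _ *+ X](card_ord N.+1) -sumr_const.
  by apply: ler_sum => j _; have [] := Hkj j.
have -> : u (kj 0%N) - d = (u (kj 0%N) - us) + (us - a) + (a - d).
  by rewrite !subrKA.
rewrite (le_trans (ler_normD _ _))// (_ : e = e / 4 + e / 4 + e / 2); last by field.
apply: lerD; last by rewrite (le_trans (ltW Hd))//; lra.
by rewrite (le_trans (ler_normD _ _))// lerD// distrC.
Qed.

End averaged_directions.

(** * Limit curves of the iterates *)

Section convexity.
Context {R : realType} {n p : nat}.
Local Notation Z := ('cV[R]_n * 'cV[R]_p)%type.

Lemma convex_values_comb (D : Z -> set Z) (w d1 d2 : Z) (a b : R) :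
  convex_values D -> D w d1 -> D w d2 -> 0 < a -> 0 < b ->
  D w ((a + b)^-1 *: (a *: d1 + b *: d2)).
Proof.
move=> cD D1 D2 a0 b0; have ab0 : 0 < a + b by rewrite addr_gt0.
have l0 : 0 <= a / (a + b) by rewrite divr_ge0// ltW.
have l1 : a / (a + b) <= 1 by rewrite ler_pdivrMr// mul1r lerDl ltW.
have := cD w d1 d2 (Itv01 l0 l1) (mem_set D1) (mem_set D2).
move/set_mem; rewrite /conv /=.
congr (D w _); rewrite scalerDr !scalerA [_^-1 * a]mulrC; congr (_ + _ *: _).
rewrite -[LHS]/(1 - a / (a + b)); field; exact: lt0r_neq0.
Qed.

(** Induction on [b]: the new element is a convex combination of the previous one and of that for
    [b], weighted by the accumulated step sizes and [eta b]. *)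
Lemma convex_weighted_sum (D : Z -> set Z) (zt : Z) (u : nat -> Z) (eta : nat -> R)
    (e : R) (a b : nat) : convex_values D -> (a < b)%N -> (forall k, 0 < eta k) ->
  (forall j, (a <= j < b)%N -> exists2 d, D zt d & `|u j - d| <= e) ->
  exists2 d, D zt d & `|\sum_(a <= j < b) eta j *: u j - (\sum_(a <= j < b) eta j) *: d|
    <= (\sum_(a <= j < b) eta j) * e.
Proof.
move=> cD ab eta0; elim: b ab => // b IH; rewrite ltnS leq_eqVlt => /predU1P[<-|ab] H.
  have [d Dd Hd] := H a (introT andP (conj (leqnn a) (ltnSn a))).
  exists d => //; rewrite !big_nat1 -scalerBr normrZ gtr0_norm// ler_wpM2l// ltW//.
have [d1 D1 H1] := IH ab (fun j jab => H j (introT andP (conj (proj1 (andP jab))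
   (ltnW (proj2 (andP jab)))))).
have [|d2 D2 H2] := H b; first by rewrite (ltnW ab) /=.
rewrite !(big_nat_recr b)//= ?(ltnW ab)//.
set S := \sum_(a <= i < b) eta i in H1 *.
have S0 : 0 < S.
  by rewrite /S big_ltn// ltr_pwDl// sumr_ge0// => i _; exact: ltW.
exists ((S + eta b)^-1 *: (S *: d1 + eta b *: d2)).
  exact: convex_values_comb.
rewrite scalerA divff ?lt0r_neq0 ?addr_gt0// scale1r opprD addrACA -scalerBr.
rewrite (le_trans (ler_normD _ _))// mulrDl lerD// normrZ gtr0_norm// ler_wpM2l// ltW//.
Qed.
End convexity.

(** * Continuous time: step sizes read as durations *)

Definition elapsed (R : realType) (eta : nat -> R) (k : nat) : R := \sum_(0 <= i < k) eta i.

(** The discrete time shift: [w (idx k t)] is the iterate seen a time [t] after step [k]. As a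
    predicate on [idx], it confines the divergence of the step sizes to the existence lemma. *)
Definition first_index (R : realType) (eta : nat -> R) (idx : nat -> R -> nat) :=
  forall k t, [/\ (k <= idx k t)%N, elapsed eta k + t <= elapsed eta (idx k t) &
    forall i, (k <= i)%N -> elapsed eta k + t <= elapsed eta i -> (idx k t <= i)%N].

Section elapsed_time.
Context {R : realType}.
Variable eta : nat -> R.
Hypothesis eta0 : forall k, 0 < eta k.
Local Notation tau := (elapsed eta).

Lemma elapsedS k : tau k.+1 = tau k + eta k.
Proof. by rewrite /elapsed big_nat_recr. Qed.

Lemma elapsedB a b : (a <= b)%N -> tau b - tau a = \sum_(a <= i < b) eta i.
Proof. by move=> ab; rewrite /elapsed (big_cat_nat (n := a))//= [LHS]addrC addKr. Qed.

Lemma elapsed_le a b : (a <= b)%N -> tau a <= tau b.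
Proof.
by move=> ab; rewrite -subr_ge0 elapsedB// sumr_ge0// => i _; exact: ltW.
Qed.

Lemma elapsed_lt a b : tau a < tau b -> (a < b)%N.
Proof. by apply: contraTT; rewrite -leqNgt -leNgt => /elapsed_le. Qed.

Lemma first_index_exists : (forall A, exists k, A <= tau k) ->
  exists idx, first_index eta idx.
Proof.
move=> taudiv.
have ex k t : exists i, (k <= i)%N && (tau k + t <= tau i).
  have [i Hi] := taudiv (tau k + t); exists (maxn k i).
  by rewrite leq_maxl (le_trans Hi)// elapsed_le// leq_maxr.
exists (fun k t => ex_minn (ex k t)) => k t.
case: ex_minnP => m /andP[km Hm] mmin; split => // i ki Hi.
by apply: mmin; rewrite ki.
Qed.

Variable idx : nat -> R -> nat.
Hypothesis idxP : first_index eta idx.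

Lemma first_index0 k : idx k 0 = k.
Proof.
have [k1 _ k2] := idxP k 0; apply/eqP; rewrite eqn_leq k1 andbT.
by apply: k2 => //; rewrite addr0.
Qed.

(** Minimality of the index bounds the overshoot by the last step size, which tends to 0 uniformly
    in [t]. *)
Lemma first_index_time : eta @ \oo --> 0 -> forall e, 0 < e ->
  \forall k \near \oo, forall t, 0 <= t -> t <= tau (idx k t) - tau k <= t + e.
Proof.
move=> eta_cvg e e0.
have /cvgrPdist_le/(_ _ e0)[K _ HK] := eta_cvg.
exists K => // k /= Kk t t0; have [k1 k2 k3] := idxP k t.
apply/andP; split; first by rewrite lerBrDl.
move: k1; rewrite leq_eqVlt => /predU1P[<-|k1]; first by rewrite subrr addr_ge0// ltW.
case: (idx k t) k1 k2 k3 => // i; rewrite ltnS => ki _ k3.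
have ti : tau i < tau k + t.
  by rewrite ltNge; apply/negP => /(k3 _ ki); rewrite ltnn.
have := HK i (leq_trans Kk ki); rewrite sub0r normrN gtr0_norm// => ei.
by rewrite elapsedS; lra.
Qed.

End elapsed_time.

(** * The limit curve and its difference quotients *)

Section flow.
Context {R : realType} {n p : nat}.
Local Notation Z := ('cV[R]_n * 'cV[R]_p)%type.
Variables (w u : nat -> Z) (eta : nat -> R) (D : Z -> set Z) (B C : R).
Hypothesis wS : forall k, w k.+1 = w k - eta k *: u k.
Hypothesis uC : forall k, `|u k| <= C.
Hypothesis wB : forall k, `|w k| <= B.
Hypothesis eta0 : forall k, 0 < eta k.
Hypothesis eta_cvg : eta @ \oo --> 0.
Hypothesis Dcompact : forall z, compact (D z).
Hypothesis Dconvex : convex_values D.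
Hypothesis nearD : forall zt e, 0 < e -> exists rho, exists K : nat,
  0 < rho /\ forall j, (K <= j)%N -> `|w j - zt| < rho ->
    exists2 d, D zt d & `|u j - d| <= e.
Local Notation tau := (elapsed eta).

Lemma iterates_sub a b : (a <= b)%N -> w a - w b = \sum_(a <= i < b) eta i *: u i.
Proof.
move=> ab; rewrite -[LHS]opprB -(telescope_sumr _ ab) -sumrN.
by apply: eq_bigr => i _; rewrite wS opprB subKr.
Qed.

Let C0 : 0 <= C. Proof. exact: le_trans (uC 0). Qed.

Lemma iterates_lipschitz a b : `|w a - w b| <= C * `|tau a - tau b|.
Proof.
wlog ab : a b / (a <= b)%N.
  by move=> H; have [/H//|/ltnW/H] := leqP a b; rewrite distrC [`|tau _ - _|]distrC.
rewrite iterates_sub// (le_trans (ler_norm_sum _ _ _))//.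
rewrite distrC ger0_norm ?subr_ge0 ?elapsed_le// elapsedB// mulr_sumr.
by apply: ler_sum => i _; rewrite normrZ gtr0_norm// mulrC ler_wpM2r// ltW.
Qed.

Variable U : set_system nat.
Hypothesis UU : UltraFilter U.
Hypothesis oU : \oo `<=` U.
Variable idx : nat -> R -> nat.
Hypothesis idxP : first_index eta idx.
Variable zeta : R -> Z.
Hypothesis zetaP : forall t, 0 <= t -> (fun k => w (idx k t)) @ U --> zeta t.

Lemma flow0 : w @ U --> zeta 0.
Proof.
have := zetaP (lexx 0); rewrite (_ : (fun k => w (idx k 0)) = w)//.
by apply/funext => k /=; rewrite (first_index0 idxP).
Qed.

Lemma flow_bounded t : 0 <= t -> `|zeta t| <= B.
Proof. by move=> t0; apply: (cvgr_to_le (cvg_norm (zetaP t0))); near do exact: wB.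
Unshelve. all: by end_near. Qed.

Lemma flow_lipschitz s t : 0 <= s -> 0 <= t -> `|zeta s - zeta t| <= C * `|s - t|.
Proof.
move=> s0 t0; apply/ler_addgt0Pr => e e0.
have e1 : 0 < e / (C + 1) by rewrite divr_gt0// ltr_wpDl.
apply: (cvgr_to_le (cvg_norm (cvgB (zetaP s0) (zetaP t0)))).
have := oU (first_index_time eta0 idxP eta_cvg e1).
apply: filterS => k Hk /=; rewrite (le_trans (iterates_lipschitz _ _))//.
have /andP[a1 a2] := Hk _ s0; have /andP[b1 b2] := Hk _ t0.
have : `|tau (idx k s) - tau (idx k t)| <= `|s - t| + e / (C + 1).
  rewrite ler_norml; have := ler_norm (s - t); have := ler_norm (t - s).
  by rewrite distrC => h1 h2; apply/andP; split; lra.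
move=> /(ler_wpM2l C0)/le_trans; apply; rewrite mulrDr lerD2l.
by rewrite mulrA ler_pdivrMr ?ltr_wpDl// mulrC ler_wpM2l ?(ltW e0)// lerDl.
Qed.

(** All iterates between the two times stay near [zeta t0], so their directions are near
    [D (zeta t0)], and convexity handles the weighted sum. What remains is the error of the limit
    and that of discrete time. *)
Lemma flow_quotient t0 e : 0 <= t0 -> 0 < e -> exists2 r, 0 < r &
  forall s t, 0 <= s -> s < t -> `|s - t0| < r -> `|t - t0| < r ->
  exists2 d, D (zeta t0) d & `|zeta s - zeta t - (t - s) *: d| <= (t - s) * e.
Proof.
move=> t00 e0.
have e2 : 0 < e / 2 by rewrite divr_gt0.
have [rho [K [rho0 HK]]] := nearD (zeta t0) e2.
have [M HM] := compact_norm_bounded (@Dcompact (zeta t0)).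
have C1 : 0 < C + 1 by rewrite ltr_wpDl.
(* A time window of [4 * r] at speed [C] moves the iterates by at most [rho / 2]. *)
pose r := rho / (8 * (C + 1)).
have r0 : 0 < r by rewrite divr_gt0// mulr_gt0.
exists r => // s t s0 st srt trt.
have t0' : 0 <= t by rewrite (le_trans s0)// ltW.
pose N := 1 + e / 2 + `|M|.
have N0 : 0 < N by rewrite /N -addrA ltr_pwDl// addr_ge0// ltW.
have ts0 : 0 < t - s by rewrite subr_gt0.
(* Chosen so that [e3 * N] is half of the allowed error: the terms of [N] account for the limit
   error, the surplus time in the averaging error, and the surplus time multiplied by [d]. *)
pose e3 := (t - s) * (e / 2) / N.
have e30 : 0 < e3 by rewrite !divr_gt0// mulr_gt0.
(* The bound [(t - s) / 2] forces the two indices to be distinct and ordered, as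
   [convex_weighted_sum] requires. *)
pose e4 := Num.min r (Num.min e3 ((t - s) / 2)).
have e40 : 0 < e4 by rewrite !lt_min r0 e30 divr_gt0.
have H1 : \forall k \near U, (K <= k)%N by apply: oU; exact: nbhs_infty_ge.
have H2 := oU (first_index_time eta0 idxP eta_cvg e40).
have rho2 : 0 < rho / 2 by rewrite divr_gt0.
have H3 : \forall k \near U, `|zeta t0 - w (idx k t0)| < rho / 2.
  by have /cvgrPdist_lt/(_ _ rho2) := zetaP t00.
have H4 : \forall k \near U, `|zeta s - zeta t - (w (idx k s) - w (idx k t))| <= e3.
  have cst : w (idx k s) - w (idx k t) @[k --> U] --> zeta s - zeta t.
    by apply: cvgB; exact: zetaP.
  by have /cvgrPdist_le/(_ _ e30) := cst.
have [k [[Kk Hk2] [Hk3 Hk4]]] := filter_ex (filterI (filterI H1 H2) (filterI H3 H4)).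
have /andP[a1 a2] := Hk2 _ s0; have /andP[b1 b2] := Hk2 _ t0'.
have /andP[c1 c2] := Hk2 _ t00.
have [er ee3 et] : [/\ e4 <= r, e4 <= e3 & e4 <= (t - s) / 2].
  by split; rewrite /e4 !ge_min lexx ?orbT.
set a := idx k s in a1 a2 Hk4 *; set b := idx k t in b1 b2 Hk4 *.
have ab : (a < b)%N by apply: (elapsed_lt eta0); lra.
have [|d Dd] := convex_weighted_sum Dconvex ab eta0 (zt := zeta t0) (u := u) (e := e / 2).
  move=> j /andP[aj jb]; apply: HK.
    by apply: leq_trans aj; have [ka _ _] := idxP k s; exact: leq_trans ka.
  rewrite (_ : w j - _ = (w j - w (idx k t0)) - (zeta t0 - w (idx k t0))); last first.
    by rewrite opprB addrA subrK.
  rewrite (le_lt_trans (ler_normB _ _))// (splitr rho) ler_ltD//.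
  rewrite (le_trans (iterates_lipschitz _ _))//.
  have T3 : `|tau j - tau (idx k t0)| <= 4 * r.
    have := elapsed_le eta0 aj; have := elapsed_le eta0 (ltnW jb).
    move: srt trt; rewrite !ltr_norml => /andP[x1 x2] /andP[y1 y2] z1 z2.
    by rewrite ler_norml; apply/andP; split; lra.
  rewrite (le_trans (ler_wpM2l C0 T3))// /r.
  rewrite (_ : C * _ = C / (C + 1) * (rho / 2)); last by field; exact: lt0r_neq0.
  by rewrite ger_pMl// ler_pdivrMr// mul1r lerDl.
rewrite -iterates_sub ?(ltnW ab)// -elapsedB ?(ltnW ab)//; set S := tau b - tau a => Hd.
have SE : `|S - (t - s)| <= e4 by rewrite ler_norml /S; apply/andP; split; lra.
exists d => //.
rewrite (_ : _ - _ = (zeta s - zeta t - (w a - w b)) + (w a - w b - S *: d) + (S - (t - s)) *: d);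
  last by rewrite [X in _ = _ + X]scalerBl !subrKA.
rewrite (le_trans (ler_normD _ _))//.
apply: (@le_trans _ _ (e3 + (t - s + e4) * (e / 2) + e4 * `|M|)).
  apply: lerD; last first.
    by rewrite normrZ ler_pM// (le_trans (HM _ Dd))// ler_norm.
  rewrite (le_trans (ler_normD _ _))// lerD// (le_trans Hd)// ler_wpM2r ?(ltW e2)//.
  by rewrite /S; lra.
apply: (@le_trans _ _ (e3 * N + (t - s) * (e / 2))).
  rewrite /N !mulrDr mulr1 mulrDl.
  have := ler_wpM2r (ltW e2) ee3; have := ler_wpM2r (normr_ge0 M) ee3; lra.
rewrite /e3 divfK ?lt0r_neq0//; lra.
Qed.

(** Compactness keeps [D (zeta 0)] at a distance [e] from 0, whereas a return to [zeta 0] at a small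
    time would give an element of norm at most [e]. *)
Lemma flow_leaves : ~ D (zeta 0) 0 ->
  exists2 r, 0 < r & forall t, 0 < t < r -> zeta 0 != zeta t.
Proof.
move=> nD0.
have [e e0 He] : exists2 e, 0 < e & forall d, D (zeta 0) d -> e < `|d|.
  apply: contrapT => H; apply: nD0; apply: compact_approx => // e e0.
  apply: contrapT => H'; apply: H; exists e => // d Dd.
  rewrite ltNge; apply/negP => de; apply: H'; exists d => //.
  by rewrite sub0r normrN.
have [r r0 Hr] := flow_quotient (lexx 0) e0.
exists r => // t /andP[t0 tr]; apply/eqP => E.
have [||d Dd] := Hr 0 t (lexx 0) t0; first by rewrite subrr normr0.
  by rewrite subr0 gtr0_norm.
rewrite E subrr sub0r normrN subr0 normrZ gtr0_norm// ler_pM2l// leNgt.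
by rewrite He.
Qed.

(** A forward step [h] of the reversed curve is a backward step [T * h] of [zeta], so
    [flow_quotient] places [ds] within any error of [T] times an element of [D]; compactness
    concludes. The clamp is inactive near such [t]. *)
Lemma reversed_flow_derive (T t : R) (ds : Z) : 0 < T -> 0 < t < 1 ->
  is_derive t (1 : R) (fun s => zeta (Num.max 0 (T * (1 - s)))) ds ->
  exists2 d, D (zeta (Num.max 0 (T * (1 - t)))) d & ds = T *: d.
Proof.
move=> T0 /andP[t0 t1] [dsd dsE].
set t' := T * (1 - t).
have t'0 : 0 < t' by rewrite mulr_gt0// subr_gt0.
rewrite (max_r (ltW t'0)).
exists (T^-1 *: ds); last by rewrite scalerA divff ?lt0r_neq0// scale1r.
apply: compact_approx => // e e0.
have e2 : 0 < e / 2 by rewrite divr_gt0.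
have eT : 0 < e / 2 * T by rewrite mulr_gt0.
have [r r0 Hr] := flow_quotient (ltW t'0) e2.
have Q : h^-1 *: (zeta (Num.max 0 (T * (1 - (h *: (1 : R) + t)))) - zeta t') @[h --> 0^'] --> ds.
  have E1 : zeta t' = zeta (Num.max 0 (T * (1 - t))) by rewrite max_r// ltW.
  by rewrite E1 -dsE; exact: dsd.
have /cvgrPdist_le/(_ _ eT)[r1 r10 Hr1] := Q.
pose m := Num.min r1 (Num.min (r / T) (1 - t)).
have m0 : 0 < m by rewrite !lt_min r10 divr_gt0// subr_gt0.
pose h := m / 2.
have h0 : 0 < h by rewrite divr_gt0.
have hm : h < m by rewrite /h ltr_pdivrMr// ltr_pMr// ltr1n.
have Hh : `|ds - h^-1 *: (zeta (Num.max 0 (T * (1 - (h + t)))) - zeta t')| <= e / 2 * T.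
  have := Hr1 h; rewrite /= [h *: 1]mulr1; apply; last exact: lt0r_neq0.
  by rewrite /ball_/= sub0r normrN gtr0_norm// (lt_le_trans hm)// ge_min lexx.
clearbody h; move: hm; rewrite lt_min => /andP[_ hm].
move: hm; rewrite lt_min => /andP[hr h1].
have E : T * (1 - (h + t)) = t' - T * h by rewrite /t'; ring.
have Th : T * h < t' by rewrite /t' ltr_pM2l.
have Th0 : 0 < T * h by rewrite mulr_gt0.
have rTh : T * h < r by rewrite mulrC -ltr_pdivlMr.
rewrite E max_r in Hh; last by rewrite subr_ge0 ltW.
have [||||d Dd] := Hr (t' - T * h) t'.
- by rewrite subr_ge0 ltW.
- by rewrite gtrBl.
- by rewrite addrC addKr normrN gtr0_norm.
- by rewrite subrr normr0.
rewrite subKr => Hd; exists d => //.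
rewrite -(ler_pM2l T0) -{1}(gtr0_norm T0) -normrZ scalerBr scalerA divff ?lt0r_neq0// scale1r.
set X := zeta _ - zeta _ in Hd Hh *; clearbody X.
rewrite (_ : ds - _ = (ds - h^-1 *: X) + h^-1 *: (X - (T * h) *: d)); last first.
  by rewrite scalerBr subrKA scalerA [T * h]mulrC mulKf ?lt0r_neq0.
rewrite (le_trans (ler_normD _ _))// (_ : T * e = e / 2 * T + e / 2 * T); last by field.
rewrite lerD// normrZ gtr0_norm ?invr_gt0// mulrC ler_pdivrMr//.
by rewrite (le_trans Hd)// le_eqVlt; apply/orP; left; apply/eqP; ring.
Qed.

End flow.

(** * Convergence of the values *)

Section lyapunov.
Context {R : realType} {n p : nat}.
Local Notation Z := ('cV[R]_n * 'cV[R]_p)%type.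
Variables (w : nat -> Z) (eta : nat -> R) (D : Z -> set Z) (B C Lh : R) (hh : Z -> R).
Variable idx : nat -> R -> nat.
Hypothesis wB : forall k, `|w k| <= B.
Hypothesis eta0 : forall k, 0 < eta k.
Hypothesis eta_cvg : eta @ \oo --> 0.
Hypothesis idxP : first_index eta idx.
Hypothesis C0 : 0 <= C.
Hypothesis w_lip : forall a b, `|w a - w b| <= C * `|elapsed eta a - elapsed eta b|.
Hypothesis Lh0 : 0 <= Lh.
Hypothesis h_lip : forall z1 z2, `|z1| <= B -> `|z2| <= B ->
  `|hh z1 - hh z2| <= Lh * `|z1 - z2|.
Hypothesis crit_interior : interior [set hh z | z in [set z | D z 0]] = set0.
Hypothesis flow_decreases : forall U : set_system nat, UltraFilter U -> \oo `<=` U ->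
  exists zeta : R -> Z, [/\ w @ U --> zeta 0,
    (forall t, 0 <= t -> (fun k => w (idx k t)) @ U --> zeta t),
    (forall t, 0 <= t -> `|zeta t| <= B) &
    ~ D (zeta 0) 0 -> exists2 r, 0 < r & forall t, 0 < t < r -> hh (zeta t) < hh (zeta 0)].

Lemma cvg_hh (U : set_system nat) (a : nat -> Z) (l : Z) : Filter U ->
  (forall k, `|a k| <= B) -> `|l| <= B -> a @ U --> l -> (fun k => hh (a k)) @ U --> hh l.
Proof.
move=> FU aB lB al; apply/cvgrPdist_le => e e0.
have e1 : 0 < e / (Lh + 1) by rewrite divr_gt0// ltr_wpDl.
have /cvgrPdist_le/(_ _ e1) := al; apply: filterS => k Hk.
rewrite (le_trans (h_lip lB (aB k)))//.
rewrite (le_trans (ler_wpM2l Lh0 Hk))// mulrA ler_pdivrMr ?ltr_wpDl// mulrC.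
by rewrite ler_wpM2l ?(ltW e0)// lerDl.
Qed.

Lemma last_below (a b : R) (j0 m : nat) : (j0 <= m)%N -> hh (w j0) <= a -> a < b ->
  b <= hh (w m) ->
  exists j, [/\ (j0 <= j < m)%N, hh (w j) <= a & forall l, (j < l <= m)%N -> a < hh (w l)].
Proof.
move=> j0m h0 ab hm.
have ex : exists j, (j0 <= j <= m)%N && (hh (w j) <= a) by exists j0; rewrite leqnn j0m.
have bd j : (j0 <= j <= m)%N && (hh (w j) <= a) -> (j <= m)%N by move=> /andP[/andP[]].
case: (ex_maxnP ex bd) => j /andP[/andP[j1 j2] hj] jmax.
exists j; split => //.
  rewrite j1 ltn_neqAle j2 andbT; apply/eqP => jm; move: hj; rewrite jm leNgt.
  by rewrite (lt_le_trans ab).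
move=> l /andP[jl lm]; rewrite ltNge; apply/negP => hl.
have := jmax l; rewrite hl lm (leq_trans j1 (ltnW jl)) => /(_ isT).
by rewrite leqNgt jl.
Qed.

(** The limit curve starts at a noncritical level [c] yet cannot go below [c] for a positive time,
    against the strict decrease. *)
Lemma no_oscillation (a b : R) : a < b ->
  (forall K, exists2 k, (K <= k)%N & hh (w k) <= a) ->
  (forall K, exists2 k, (K <= k)%N & b <= hh (w k)) -> False.
Proof.
move=> ab freqa freqb.
(* Critical values fill no interval, so one between [a] and [b] is missed. *)
have [c /andP[ac cb] cV] : exists2 c, a < c < b &
    ~ exists2 z, D z 0 & hh z = c.
  apply: contrapT => H.
  have : interior [set hh z | z in [set z | D z 0]] ((a + b) / 2).
    apply: (@filterS _ _ _ `]a, b[%classic); last first.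
      by apply: near_in_itvoo; rewrite in_itv/= !midf_lt.
    move=> c; rewrite /= in_itv/= => cab; apply: contrapT => H'.
    by apply: H; exists c.
  by rewrite crit_interior.
pose A := [set j : nat | hh (w j) <= c /\ exists m, [/\ (j < m)%N, b <= hh (w m) &
  forall l, (j < l <= m)%N -> c < hh (w l)]].
have [i|i j ij k [jk Ak]|U [UU HU]] := @ultra_of_base (fun i => [set j | (i <= j)%N /\ A j]).
- have [j0 ij0 h0] := freqa i; have [m jm hm] := freqb j0.
  have [j [/andP[j1 j2] hj jl]] := last_below jm (le_trans h0 (ltW ac)) cb hm.
  exists j; split; first exact: leq_trans j1.
  by split=> //; exists m.
- by split=> //; exact: leq_trans jk.
have oU : \oo `<=` U.
  by apply: infty_sub_filter => i; apply: filterS (HU i) => j [].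
have [zeta [z0 zt zB dec]] := flow_decreases UU oU.
have cvg0 : (fun k => hh (w k)) @ U --> hh (zeta 0).
  by apply: cvg_hh => //; exact: zB.
(* The value at [w j] is at most [c] and the next one exceeds [c]. The gap vanishes with [eta], so
   the limit is exactly [c]. *)
have h0c : hh (zeta 0) = c.
  apply/eqP; rewrite eq_le; apply/andP; split.
    by apply: (cvgr_to_le cvg0); apply: filterS (HU 0%N) => j [_ []].
  apply/ler_addgt0Pl => e e0.
  rewrite -lerBlDl; apply: (cvgr_to_ge cvg0).
  have e1 : 0 < e / (Lh * C + 1) by rewrite divr_gt0// ltr_wpDl// mulr_ge0.
  have H1 : \forall j \near U, `|eta j| <= e / (Lh * C + 1).
    have /cvgrPdist_le/(_ _ e1)/oU := eta_cvg.
    by apply: filterS => j; rewrite sub0r normrN.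
  apply: filterS (filterI H1 (HU 0%N)) => j [Hj [_ [_ [m [jm _ jl]]]]].
  have := jl j.+1; rewrite ltnSn jm => /(_ isT) hc.
  have : hh (w j.+1) - hh (w j) <= e.
    rewrite (le_trans (ler_norm _))// (le_trans (h_lip (wB _) (wB _)))//.
    rewrite (le_trans (ler_wpM2l Lh0 (w_lip _ _)))//.
    rewrite elapsedS addrC addKr mulrA.
    have LC0 : 0 <= Lh * C by rewrite mulr_ge0.
    rewrite (le_trans (ler_wpM2l LC0 Hj))// mulrA ler_pdivrMr ?ltr_wpDl// mulrC.
    by rewrite ler_wpM2l ?(ltW e0)// lerDl.
  lra.
have [D0|r r0 Hr] := dec; first by apply: cV; exists (zeta 0).
(* A lower bound for the time needed to climb from [c] to [b], values changing at rate at most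
   [Lh * C]. For [t < r1] the index [idx j t] is thus at most [m], where the values are still above
   [c]. *)
pose r1 := (b - c) / (Lh * C + 1).
have LC1 : 0 < Lh * C + 1 by rewrite ltr_wpDl// mulr_ge0.
have r10 : 0 < r1 by rewrite divr_gt0// subr_gt0.
pose t := Num.min r r1 / 2.
have m0 : 0 < Num.min r r1 by rewrite lt_min r0 r10.
have t0 : 0 < t by rewrite divr_gt0.
have tm : t < Num.min r r1 by rewrite ltr_pdivrMr// ltr_pMr// ltr1n.
have [tr tr1] : t < r /\ t < r1 by move: tm; rewrite lt_min => /andP[].
have := Hr t; rewrite t0 tr h0c => /(_ isT); rewrite ltNge => /negP; apply.
have cvgt : (fun k => hh (w (idx k t))) @ U --> hh (zeta t).
  exact: (@cvg_hh U (fun k => w (idx k t)) (zeta t) _ (fun k => wB (idx k t))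
    (zB _ (ltW t0)) (zt _ (ltW t0))).
apply: (cvgr_to_ge cvgt); apply: filterS (HU 0%N) => j [_ [hj [m [jm hm jl]]]].
apply/ltW/jl; have [k1 k2 k3] := idxP j t.
apply/andP; split; first by apply: (elapsed_lt eta0); apply: lt_le_trans k2; rewrite ltrDl.
apply: k3; first exact: ltnW.
rewrite -lerBrDl (le_trans (ltW tr1))// ler_pdivrMr//.
have jm' := elapsed_le eta0 (ltnW jm).
have T0 : 0 <= elapsed eta m - elapsed eta j by rewrite subr_ge0.
apply: (@le_trans _ _ (hh (w m) - hh (w j))); first by rewrite lerB.
rewrite (le_trans (ler_norm _))// (le_trans (h_lip (wB _) (wB _)))//.
rewrite (le_trans (ler_wpM2l Lh0 (w_lip _ _)))// ger0_norm// mulrA mulrC.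
by rewrite ler_wpM2l// lerDl.
Qed.

(** An ultralimit [l] is approached at arbitrarily large indices. If it is not the limit, the values
    either reach [l + e] infinitely often, or eventually stay below it and then fall to [l - e]
    infinitely often; both are oscillations. *)
Lemma values_converge : exists l : R, (fun k => hh (w k)) @ \oo --> l.
Proof.
have [U [UU oU]] := ultraFilterLemma eventually_filter.
have hB k : `|hh (w k)| <= Lh * (B + B) + `|hh (w 0%N)|.
  rewrite -lerBlDr (le_trans (lerB_dist _ _))// (le_trans (h_lip (wB _) (wB _)))//.
  by rewrite ler_wpM2l// (le_trans (ler_normB _ _))// lerD.
have [l Hl] := real_ultralimit UU hB.
have freq K e : 0 < e -> exists2 k, (K <= k)%N & `|l - hh (w k)| < e.
  move=> e0; have /cvgrPdist_lt/(_ _ e0) H := Hl.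
  have HK : U [set k | (K <= k)%N] by apply: oU; exact: nbhs_infty_ge.
  by have [k [k1 k2]] := filter_ex (filterI H HK); exists k.
exists l; apply/cvgrPdist_lt => e e0; apply: contrapT => nH.
have far K : exists2 k, (K <= k)%N & e <= `|l - hh (w k)|.
  apply: contrapT => H; apply: nH; exists K => // k /= Kk.
  by rewrite ltNge; apply/negP => ek; apply: H; exists k.
have e2 : 0 < e / 2 by rewrite divr_gt0.
have [up|nup] := pselect (forall K, exists2 k, (K <= k)%N & l + e <= hh (w k)).
  apply: (@no_oscillation (l + e / 2) (l + e)) up; first by lra.
  move=> K; have [k Kk Hk] := freq K _ e2; exists k => //.
  by move: Hk; rewrite ltr_norml => /andP[h1 h2]; lra.
have [K0 HK0] : exists K0, forall k, (K0 <= k)%N -> hh (w k) < l + e.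
  apply: contrapT => H; apply: nup => K; apply: contrapT => H'; apply: H.
  exists K => k Kk; rewrite ltNge; apply/negP => hk; apply: H'; by exists k.
apply: (@no_oscillation (l - e) (l - e / 2)); first by lra.
  move=> K; have [k Kk Hk] := far (maxn K K0); exists k.
    by apply: leq_trans Kk; exact: leq_maxl.
  have := HK0 k (leq_trans (leq_maxr _ _) Kk).
  move: Hk; rewrite ler_normr => /orP[] ? ?; lra.
move=> K; have [k Kk Hk] := freq K _ e2; exists k => //.
by move: Hk; rewrite ltr_norml => /andP[h1 h2]; lra.
Qed.

(** Since the values converge, [hh] is constant along a limit curve starting at [zt], so it cannot
    decrease strictly. *)
Lemma limit_point_critical (zt : Z) :
  (forall e K, 0 < e -> exists2 k, (K <= k)%N & `|w k - zt| < e) -> D zt 0.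
Proof.
move=> Hzt; apply: contrapT => nD.
have [i|i j ij k [jk Hk]|U [UU HU]] :=
    @ultra_of_base (fun i => [set j | (i <= j)%N /\ `|w j - zt| < i.+1%:R^-1]).
- have i0 : 0 < i.+1%:R^-1 :> R by rewrite invr_gt0.
  by have [k k1 k2] := Hzt _ i i0; exists k.
- split; first exact: leq_trans jk.
  by apply: (lt_le_trans Hk); rewrite lef_pV2 ?posrE// ler_nat.
have oU : \oo `<=` U.
  by apply: infty_sub_filter => i; apply: filterS (HU i) => j [].
have [zeta [z0 zlim zB dec]] := flow_decreases UU oU.
have z0E : zeta 0 = zt.
  apply: (cvg_unique _ z0) => //.
  apply/cvgrPdist_lt => e e0.
  have [N _ HN] := near_infty_natSinv_lt (PosNum e0).
  apply: filterS (HU N) => j [_ Hj]; rewrite distrC (lt_trans Hj)//.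
  exact: (HN N (leqnn _)).
rewrite z0E in dec; have [r r0 Hr] := dec nD.
have r2 : 0 < r / 2 by rewrite divr_gt0.
have [l Hl] := values_converge.
have E1 : hh zt = l.
  rewrite -z0E; have H : (fun k => hh (w k)) @ U --> hh (zeta 0).
    by apply: cvg_hh => //; exact: zB.
  by apply: (cvg_unique _ H) => //; exact: cvg_sub_filter Hl.
have E2 : hh (zeta (r / 2)) = l.
  have H : (fun k => hh (w (idx k (r / 2)))) @ U --> hh (zeta (r / 2)).
    exact: (@cvg_hh U (fun k => w (idx k (r / 2))) (zeta (r / 2)) _
      (fun k => wB (idx k (r / 2))) (zB _ (ltW r2)) (zlim _ (ltW r2))).
  apply: (cvg_unique _ H) => //; apply/cvgrPdist_lt => e e0.
  have /cvgrPdist_lt/(_ _ e0)[N _ HN] := Hl.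
  apply: oU; exists N => // k /= Nk; apply: HN => /=.
  by have [k1 _ _] := idxP k (r / 2); exact: leq_trans k1.
have := Hr (r / 2); rewrite r2 E1 E2 ltxx ltr_pdivrMr// ltr_pMr// ltr1n.
by move=> /(_ isT).
Qed.

End lyapunov.

(** * Strict decrease along limit curves, and removal of the noise *)

Section flow_descent.
Context {R : realType} {n p : nat}.
Local Notation Z := ('cV[R]_n * 'cV[R]_p)%type.
Variables (f g : Z -> R) (Df D : Z -> set Z) (Mf mu Lg Qg beta delta : R).
Hypothesis hA1 : assumption_A1 f g Mf mu Lg Qg.
Hypothesis hA2 : assumption_A2 f Df Mf.
Hypothesis hdelta : 0 < delta.
Hypothesis hf : forall z w, D z w ->
  ((delta * pnorm w ^+ 2)%:E <= ereal_sup [set (pdot zeta w)%:E | zeta in Dh Df g beta z])%E.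

(** The clamp extends the reversed curve to the whole line with Lipschitz constant [C * T], as
    [curve_descent] requires, and changes nothing on the unit interval. *)
Lemma reversed_curve_descent (zeta : R -> Z) (B C T : R) : 0 < T ->
  (forall t, 0 <= t -> `|zeta t| <= B) ->
  (forall s t, 0 <= s -> 0 <= t -> `|zeta s - zeta t| <= C * `|s - t|) ->
  (forall (t : R) ds, 0 < t < 1 ->
     is_derive t (1 : R) (fun s => zeta (Num.max 0 (T * (1 - s)))) ds ->
     exists2 d, D (zeta (Num.max 0 (T * (1 - t)))) d & ds = T *: d) ->
  zeta 0 != zeta T -> hfun f g beta (zeta T) < hfun f g beta (zeta 0).
Proof.
move=> T0 zB zL incl neq.
pose s (t : R) := zeta (Num.max 0 (T * (1 - t))).
have m0 (a : R) : 0 <= Num.max 0 a by rewrite le_max lexx.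
have C0 : 0 <= C.
  have := zL 1 0 ler01 (lexx 0); rewrite subr0 normr1 mulr1; exact: le_trans.
have sL : lipschitz_with (C * T) s.
  move=> a b; rewrite (le_trans (zL _ _ (m0 _) (m0 _)))// -mulrA ler_wpM2l//.
  rewrite -[X in X * `|a - b|](gtr0_norm T0) -normrM.
  rewrite [leRHS](_ : _ = `|T * (1 - a) - T * (1 - b)|); last first.
    by rewrite -normrN; congr (`|_|); ring.
  move: (T * (1 - a)) (T * (1 - b)) => x y.
  by rewrite /Num.max; case: ltP => hx; case: ltP => hy; rewrite !ler_norml;
     have := ler_norm (x - y); have := ler_norm (y - x); rewrite distrC => ? ?;
     apply/andP; split; lra.
have s1 : s 1 = zeta 0 by rewrite /s subrr mulr0 maxxx.
have s0 : s 0 = zeta T by rewrite /s subr0 mulr1 max_r// ltW.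
(* This [a] maximizes [2 <a, v> - T |a|^2] for [v = s 1 - s 0]; the maximum [|v|^2 / T] is
   positive. *)
have := @curve_descent _ _ _ f g Df D Mf mu Lg Qg beta delta hA1 hA2 hdelta hf
  s (C * T) B T (T^-1 *: (s 1 - s 0)) T0 sL (fun t => zB _ (m0 _)) incl.
rewrite -subr_gt0 s1 s0; apply: lt_le_trans.
set v := zeta 0 - zeta T.
have v0 : 0 < pdot v v by apply: pdot_gt0; rewrite subr_eq0.
rewrite pdotZr !(pdotC (T^-1 *: v)) !pdotZr.
rewrite (_ : _ * (_ - _) = delta * (T^-1 * pdot v v)); last first.
  by field; exact: lt0r_neq0.
by rewrite !mulr_gt0// invr_gt0.
Qed.


Variables (z u xi : nat -> Z) (eta : nat -> R) (v : Z) (B0 : R).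
Hypothesis zS : forall k, z k.+1 = z k - eta k *: (u k + xi k).
Hypothesis zB0 : forall k, `|z k| <= B0.
Hypothesis eta0 : forall k, 0 < eta k.
Hypothesis eta_div : (fun N => \sum_(k < N.+1) eta k) @ \oo --> +oo.
Hypothesis eta_sq : cvgn (fun N => \sum_(k < N.+1) eta k ^+ 2).
Hypothesis xi_cvg : (fun N => \sum_(k < N.+1) eta k *: xi k) @ \oo --> v.
Hypothesis Dcompact : forall w, compact (D w).
Hypothesis Dconvex : convex_values D.
Hypothesis havg : forall (kj : nat -> nat) (zt : Z),
  {homo kj : a b / (a < b)%N} -> (fun j => z (kj j)) @ \oo --> zt ->
  (fun N => dist_set ((N.+1%:R)^-1 *: \sum_(j < N.+1) u (kj j)) (D zt))
    @ \oo --> (0%R)%:E.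
Hypothesis hcrit : interior [set hfun f g beta z | z in [set z | D z 0]] = set0.

Lemma iterates_convergence :
  (forall zt, (exists kj : nat -> nat, {homo kj : a b / (a < b)%N} /\
     (fun j => z (kj j)) @ \oo --> zt) -> D zt 0) /\
  (exists l : R, (fun k => hfun f g beta (z k)) @ \oo --> l).
Proof.
have [C uC] := @directions_bounded _ _ _ z u D B0 zB0 Dcompact havg.
have C0 : 0 <= C := le_trans (normr_ge0 _) (uC 0%N).
have uD := @directions_near_field _ _ _ z u D B0 zB0 Dcompact havg.
(* Square summability makes [eta] tend to 0, which controls the overshoot of the discrete time
   shift. *)
have eta_cvg : eta @ \oo --> 0.
  have H : (fun k => eta k ^+ 2) @ \oo --> 0.
    apply: cvg_series_cvg_0.
    move: eta_sq => /cvg_ex[l Hl]; apply/cvg_ex; exists l.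
    rewrite -cvg_shiftS (_ : [sequence _]_n = (fun N => \sum_(k < N.+1) eta k ^+ 2))//.
    by apply/funext => N; rewrite /series /= big_mkord.
  apply/cvgrPdist_le => e e0.
  have /cvgrPdist_le/(_ (e ^+ 2) (exprn_gt0 2 e0)) := H.
  apply: filterS => k; rewrite !sub0r !normrN normrX.
  by rewrite ler_pXn2r// nnegrE// ltW.
have taudiv A : exists k, A <= elapsed eta k.
  have /cvgryPge/(_ A)[N _ HN] := eta_div.
  by exists N.+1; have := HN N (leqnn _); rewrite /= /elapsed big_mkord.
have [idx idxP] := first_index_exists eta0 taudiv.
(* The noise still to come. Subtracting it from [z] cancels [xi] in the recursion and costs a term
   tending to 0. *)
pose tail k : Z := v - \sum_(0 <= i < k) eta i *: xi i.
have tail_cvg : tail @ \oo --> (0 : Z).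
  apply/cvgrPdist_le => e e0; have /cvgrPdist_le/(_ _ e0)[N _ HN] := xi_cvg.
  by exists N.+1 => // -[//|k] Nk; rewrite sub0r normrN /tail big_mkord; exact: HN.
pose w k : Z := z k - tail k.
have wS k : w k.+1 = w k - eta k *: u k.
  have aux (a b c d e : Z) : a - (b + c) - (d - (e + c)) = a - (d - e) - b.
    rewrite [- (e + c)]opprD [d + _]addrA opprB.
    by rewrite [- (b + c)]opprD [a + (- b - c)]addrA subrKA addrAC.
  by rewrite /w /tail big_nat_recr//= zS scalerDr aux.
have [B1 wB1] : exists B1, forall k, `|w k| <= B1.
  have /cvgrPdist_le/(_ _ ltr01)[N _ HN] := tail_cvg.
  exists (B0 + (1 + \sum_(i < N) `|tail i|)) => k.
  rewrite (le_trans (ler_normB _ _))// lerD//.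
  have [kN|Nk] := ltnP k N.
    by rewrite (bigD1 (Ordinal kN))//= addrCA lerDl addr_ge0// sumr_ge0.
  by have := HN k Nk; rewrite sub0r normrN => /le_trans; apply; rewrite lerDl sumr_ge0.
(* One radius for both sequences, so that a single Lipschitz constant of [hfun] compares values at
   [w] and at [z]. *)
pose B := Num.max B0 B1.
have zB k : `|z k| <= B by rewrite le_max zB0.
have wB k : `|w k| <= B by rewrite le_max wB1 orbT.
have wD zt e : 0 < e -> exists rho, exists K : nat,
  0 < rho /\ forall j, (K <= j)%N -> `|w j - zt| < rho ->
    exists2 d, D zt d & `|u j - d| <= e.
  move=> e0; have [rho [K [rho0 H]]] := uD zt e e0.
  have rho2 : 0 < rho / 2 by rewrite divr_gt0.
  have /cvgrPdist_lt/(_ _ rho2)[K1 _ HK1] := tail_cvg.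
  exists (rho / 2), (maxn K K1); split => // j; rewrite geq_max => /andP[Kj K1j] wj.
  apply: H => //; have := HK1 j K1j; rewrite sub0r normrN => tj.
  rewrite (_ : z j - zt = (w j - zt) + tail j); last by rewrite /w addrAC subrK.
  by rewrite (le_lt_trans (ler_normD _ _))// (splitr rho) ltrD.
have [Lh Lh0 h_lip] := hfun_lipschitz_on hA1 beta B.
have dec (U : set_system nat) : UltraFilter U -> \oo `<=` U ->
  exists zeta : R -> Z, [/\ w @ U --> zeta 0,
    (forall t, 0 <= t -> (fun k => w (idx k t)) @ U --> zeta t),
    (forall t, 0 <= t -> `|zeta t| <= B) &
    ~ D (zeta 0) 0 -> exists2 r, 0 < r & forall t, 0 < t < r ->
      hfun f g beta (zeta t) < hfun f g beta (zeta 0)].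
  move=> UU oU.
  have /choice[zeta Hz] : forall t, exists l : Z, (fun k => w (idx k t)) @ U --> l.
    by move=> t; exact: (pair_ultralimit UU (fun k => wB (idx k t))).
  have zetaP t (t0 : 0 <= t) := Hz t.
  have zb t (t0 : 0 <= t) := flow_bounded wB UU zetaP t0.
  exists zeta; split => //; first exact: (flow0 idxP zetaP).
  move=> nD.
  have [r r0 Hr] := flow_leaves wS uC eta0 eta_cvg Dcompact Dconvex wD UU oU idxP zetaP nD.
  exists r => // t t0r; have /andP[t0 tr] := t0r.
  apply: (reversed_curve_descent t0 zb _ _ (Hr t t0r)).
    exact: (flow_lipschitz wS uC eta0 eta_cvg UU oU idxP zetaP).
  move=> s ds s01 hs.
  exact: (reversed_flow_derive wS uC eta0 eta_cvg Dcompact Dconvex wD UU oU idxP zetaP t0 s01 hs).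
have w_lip := iterates_lipschitz wS uC eta0.
split.
  move=> zt [kj [kjinc kjz]].
  apply: (limit_point_critical wB eta0 eta_cvg idxP C0 w_lip Lh0 h_lip hcrit dec).
  move=> e K e0.
  have e2 : 0 < e / 2 by rewrite divr_gt0.
  have /cvgrPdist_lt/(_ _ e2)[K1 _ HK1] := kjz.
  have /cvgrPdist_lt/(_ _ e2)[K2 _ HK2] := tail_cvg.
  have kjge j : (j <= kj j)%N.
    by elim: j => // j IH; apply: (leq_ltn_trans IH); exact: kjinc.
  pose j := maxn K (maxn K1 K2).
  exists (kj j); first by apply: leq_trans (kjge j); rewrite leq_maxl.
  have A1 := HK1 j (leq_trans (leq_maxl _ _) (leq_maxr _ _)).
  have A2 := HK2 (kj j) (leq_trans (leq_trans (leq_maxr _ _) (leq_maxr _ _)) (kjge j)).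
  rewrite (_ : w _ - zt = - (zt - z (kj j)) + (0 - tail (kj j))); last first.
    by rewrite opprB sub0r /w addrAC.
  by rewrite (le_lt_trans (ler_normD _ _))// (splitr e) normrN ltrD.
have [l Hl] := values_converge wB eta0 eta_cvg idxP C0 w_lip Lh0 h_lip hcrit dec.
exists l; apply/cvgrPdist_le => e e0.
have e2 : 0 < e / 2 by rewrite divr_gt0.
have e3 : 0 < e / 2 / (Lh + 1) by rewrite divr_gt0// ltr_wpDl.
have /cvgrPdist_le/(_ _ e2) H1 := Hl.
have /cvgrPdist_le/(_ _ e3) H2 := tail_cvg.
apply: filterS (filterI H1 H2) => k [h1 h2].
apply: (le_trans (ler_distD (hfun f g beta (w k)) _ _)); rewrite (splitr e); apply: lerD; first exact: h1.
rewrite (le_trans (h_lip _ _ (wB k) (zB k)))//.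
rewrite (_ : w k - z k = 0 - tail k); last by rewrite /w addrAC subrr.
rewrite (le_trans (ler_wpM2l Lh0 h2))// mulrA ler_pdivrMr ?ltr_wpDl// mulrC.
by rewrite ler_wpM2l ?(ltW e2)// lerDl.
Qed.

End flow_descent.

Theorem theorem4p1 (R : realType) (n p : nat)
  (f g : 'cV[R]_n * 'cV[R]_p -> R)
  (Df : 'cV[R]_n * 'cV[R]_p -> set ('cV[R]_n * 'cV[R]_p))
  (Mf mu Lg Qg beta : R)
  (hA1 : assumption_A1 f g Mf mu Lg Qg)
  (hA2 : assumption_A2 f Df Mf)
  (hbeta : 0 < beta)
  (x : nat -> 'cV[R]_n) (y : nat -> 'cV[R]_p) (eta : nat -> R)
  (ux xix : nat -> 'cV[R]_n) (uy xiy : nat -> 'cV[R]_p)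
  (hx : forall k, x k.+1 = x k - eta k *: (ux k + xix k))
  (hy : forall k, y k.+1 = y k - eta k *: (uy k + xiy k))
  (D : 'cV[R]_n * 'cV[R]_p -> set ('cV[R]_n * 'cV[R]_p)) (delta : R)
  (hdelta : 0 < delta)
  (* (a) *)
  (ha : exists B : R, forall k, enorm (x k) + enorm (y k) <= B)
  (* (b) *)
  (hb_pos : forall k, 0 < eta k)
  (hb_div : (fun N => \sum_(k < N.+1) eta k) @ \oo --> +oo)
  (hb_sq : cvgn (fun N => \sum_(k < N.+1) eta k ^+ 2))
  (* (c) *)
  (hc : exists (vx : 'cV[R]_n) (vy : 'cV[R]_p),
      (fun N => \sum_(k < N.+1) eta k *: xix k) @ \oo --> vx /\
      (fun N => \sum_(k < N.+1) eta k *: xiy k) @ \oo --> vy)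
  (* (d) *)
  (hd_graph : closed_graph D)
  (hd_compact : forall z, compact (D z))
  (hd_convex : convex_values D)
  (hd_avg : forall (kj : nat -> nat) (zt : 'cV[R]_n * 'cV[R]_p),
      {homo kj : a b / (a < b)%N} ->
      (fun j => (x (kj j), y (kj j))) @ \oo --> zt ->
      (fun N => dist_set
         ((N.+1%:R)^-1 *: \sum_(j < N.+1) (ux (kj j), uy (kj j))) (D zt))
        @ \oo --> (0%R)%:E)
  (* (e) *)
  (he : interior [set hfun f g beta z | z in [set z | D z 0]] = set0)
  (* (f) *)
  (hf : forall z w, D z w ->
      ((delta * pnorm w ^+ 2)%:E <= ereal_sup [set (pdot zeta w)%:E | zeta in Dh Df g beta z])%E) :
  (forall zt : 'cV[R]_n * 'cV[R]_p,
      (exists kj : nat -> nat, {homo kj : a b / (a < b)%N} /\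
         (fun j => (x (kj j), y (kj j))) @ \oo --> zt) ->
      D zt 0) /\
  (exists l : R, (fun k => hfun f g beta (x k, y k)) @ \oo --> l).
Proof.
have [B zB] : exists B, forall k, `|(x k, y k)| <= B.
  have [B HB] := ha; exists B => k; apply: norm_pair_le => /=.
    rewrite (le_trans (norm_le_enorm _))// (le_trans _ (HB k))// lerDl; exact: sqrtr_ge0.
  rewrite (le_trans (norm_le_enorm _))// (le_trans _ (HB k))// lerDr; exact: sqrtr_ge0.
have [vx [vy [hvx hvy]]] := hc.
apply: (@iterates_convergence _ _ _ f g Df D Mf mu Lg Qg beta delta hA1 hA2 hdelta hf
  (fun k => (x k, y k)) (fun k => (ux k, uy k)) (fun k => (xix k, xiy k)) eta (vx, vy) B) => //.
- by move=> k; rewrite hx hy.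
- rewrite (_ : (fun N => _) = (fun N => (\sum_(k < N.+1) eta k *: xix k,
    \sum_(k < N.+1) eta k *: xiy k))); first exact: (cvg_pair hvx hvy).
  by apply/funext => N; elim/big_rec3: _ => // i s1 s2 s3 _ ->.
Qed.
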